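(* Let $\mathcal{A}$ be a von Neumann algebra and $S$ some collection of weakly continuous linear symmetry maps on $\mathcal{A}$. Suppose that $X,B\in\mathcal{A}$ with $X$ self-adjoint and $S$-symmetric. Let $\Omega_0\subset\subset\Omega$ be intervals in $\mathbb{R}$, and let $\Omega_-,\Omega_+$ be the left and right disjoint intervals whose union is $\Omega\setminus\Omega_0$. Suppose that there exist commuting $X',B'\in\mathcal{A}$ with $X'$ self-adjoint and $S$-symmetric. Then there is an $S$-symmetric projection $F=F_{\Omega_0,\Omega}\in\mathcal{A}$ with the following properties: (i) $E_{\Omega_0}(X)\le F\le E_\Omega(X)$. (ii) $F$ has the decomposition $F=F_-+E_{\Omega_0}(X)+F_+$, where $F_-,F_+$ are $S$-symmetric projections with $F_-\le E_{\Omega_-}(X)$ and $F_+\le E_{\Omega_+}(X)$. (iii) $$\|[F,B]\|\le\left(\frac{24}{d(\mathbb{R}\setminus\Omega,\Omega_0)}+\max\left(\frac{16}{d(\mathbb{R}\setminus\Omega,\Omega_0)},\frac{32}{d(\Omega_-,\Omega_+)}\right)\right)\|X'-X\|\,\|B\|+\|B'-B\|.$$ Also, the projections do not depend on $B$ or $B'$.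
   Context: ''Linear'' means $\mathbb{C}$-linear. A linear symmetry map on a unital $C^*$-algebra $\mathcal{A}$ is a linear map $\varphi:\mathcal{A}\to\mathcal{A}$ that is hermitian ($\varphi(A^* )=\varphi(A)^*$), maps non-invertible elements to non-invertible elements, satisfies $\varphi(I)=I$, and is multiplicative or anti-multiplicative ($\varphi(AB)=\varphi(B)\varphi(A)$). ''Weakly continuous'' refers to the weak operator topology. $A$ is $S$-symmetric if $\varphi(A)=A$ for all $\varphi\in S$. $E_\Omega(X)$ is the spectral projection of $X$ on $\Omega$. $d$ is the distance between two sets; $\Omega_0\subset\subset\Omega$ means compactly contained. $[F,B]=FB-BF$. *)

(* Defs.v *)
From HB Require Import structures.
From mathcomp Require Import all_boot all_order all_algebra.
From mathcomp Require Import complex.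
From mathcomp Require Import all_classical all_reals all_analysis.

Set Implicit Arguments.
Unset Strict Implicit.
Unset Printing Implicit Defensive.

Import Order.TTheory GRing.Theory Num.Theory.
Import numFieldNormedType.Exports.

Local Open Scope classical_set_scope.
Local Open Scope complex_scope.
Local Open Scope ring_scope.

(* A complex Hilbert space: the inner product is linear in its first argument
   and conjugate-linear in the second, and it induces the (complete) norm. *)
HB.mixin Record isHilbert (R : realType) H
    of CompleteNormedModule (R[i] : numFieldType) H := {
  inner : {dot H for (@Num.conj R[i])} ;
  inner_norm : forall u : H, inner u u = `|u| ^+ 2
}.

#[short(type="hilbertType")]
HB.structure Definition Hilbert (R : realType) :=
  { H of isHilbert R H & CompleteNormedModule (R[i] : numFieldType) H }.

Section Operators.
Context {R : realType} {H : hilbertType R}.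
Local Notation C := R[i].
Local Notation ip := (@inner R H).

(* Operators are plain functions H -> H, whose vector space structure is
   pointwise and whose product is \o; B(H) is cut out by bounded_op. *)
Definition bounded_op : set (H -> H) :=
  [set T | linear T /\ continuous T].

Definition opnorm (T : H -> H) : \bar R :=
  ereal_sup [set (complex.Re `|T u|)%:E | u in [set u : H | `|u| <= 1]].

Definition commutator (T U : H -> H) : H -> H := (T \o U) - (U \o T).

Definition is_adjoint (T U : H -> H) := forall u v, ip (T u) v = ip u (U v).

Definition self_adjoint (T : H -> H) := is_adjoint T T.

Definition projection (P : H -> H) :=
  [/\ bounded_op P, P \o P = P & self_adjoint P].

(* Complex numbers are compared by the partial order of R[i]: x <= y iff y - x
   is a nonnegative real. *)
Definition op_le (T U : H -> H) := forall u, ip (T u) u <= ip (U u) u.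

Definition matrix_coefs (T : H -> H) : {ptws H * H -> C^o} :=
  fun uv => ip (T uv.1) uv.2.

(* The weak operator topology: the coarsest topology making every
   T |-> <T u, v> continuous. *)
Local Notation wot := (initial_topology matrix_coefs).

Record von_neumann_algebra (A : set (H -> H)) : Prop := VonNeumannAlgebra {
  vna_bounded : A `<=` bounded_op ;
  vna_id : A idfun ;
  vna_linear : forall (c : C) T U, A T -> A U -> A (c *: T + U) ;
  vna_comp : forall T U, A T -> A U -> A (T \o U) ;
  vna_adjoint : forall T, A T -> exists2 U, A U & is_adjoint T U ;
  vna_closed : closure (A : set wot) `&` bounded_op `<=` A
}.

Definition invertible_in (A : set (H -> H)) (T : H -> H) :=
  exists U, [/\ A U, T \o U = idfun & U \o T = idfun].

(* A map phi : A -> A is represented by a map on all operators, of which only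
   the restriction to A matters. *)
Record linear_symmetry (A : set (H -> H)) (phi : (H -> H) -> (H -> H)) : Prop :=
  LinearSymmetry {
  lsym_maps : forall T, A T -> A (phi T) ;
  lsym_linear : forall (c : C) T U, A T -> A U ->
    phi (c *: T + U) = c *: phi T + phi U ;
  lsym_hermitian : forall T U, A T -> A U ->
    is_adjoint T U -> is_adjoint (phi T) (phi U) ;
  lsym_noninvertible : forall T, A T ->
    ~ invertible_in A T -> ~ invertible_in A (phi T) ;
  lsym_id : phi idfun = idfun ;
  lsym_mult :
    (forall T U, A T -> A U -> phi (T \o U) = phi T \o phi U) \/
    (forall T U, A T -> A U -> phi (T \o U) = phi U \o phi T)
}.

Definition weakly_continuous (A : set (H -> H))
    (phi : (H -> H) -> (H -> H)) :=
  {within (A : set wot), continuous (phi : wot -> wot)}.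

Definition S_symmetric (S : set ((H -> H) -> (H -> H))) (T : H -> H) :=
  forall phi, S phi -> phi T = T.

(* E is the projection-valued Borel measure with X = \int x dE(x), where both
   the countable additivity of E and the integral are understood weakly, that
   is, through the scalar measures Delta |-> <E(Delta) u, u>. *)
Definition is_spectral_measure (X : H -> H) (E : set R -> H -> H) :=
  [/\ forall D, measurable D -> projection (E D),
      E setT = idfun,
      forall D1 D2, measurable D1 -> measurable D2 ->
        E (D1 `&` D2) = E D1 \o E D2
    & forall u : H, exists mu : {measure set R -> \bar R},
      [/\ forall D, measurable D -> mu D = (complex.Re (ip (E D u) u))%:E,
          mu.-integrable setT (fun x : R => x%:E)
        & ip (X u) u = (Rintegral mu setT (fun x : R => x))%:C ]].

(* For bounded self-adjoint X, the spectral measure exists and its values on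
   Borel sets are unique. *)
Definition spectral_projection (X : H -> H) (D : set R) : H -> H :=
  xget (fun=> 0) [set E | is_spectral_measure X E] D.

End Operators.

Section Distance.
Context {R : realType}.

(* The distance is +oo if one of the sets is empty. *)
Definition set_dist (A B : set R) : \bar R :=
  ereal_inf [set z | exists x y, [/\ A x, B y & z = `|x - y|%:E]].

Definition compactly_contained (A B : set R) :=
  compact (closure A) /\ closure A `<=` interior B.

End Distance.

(* Main.v *)
Require Import Defs.
From HB Require Import structures.
From mathcomp Require Import all_boot all_order all_algebra.
From mathcomp Require Import complex.
From mathcomp Require Import all_classical all_reals all_analysis.
From mathcomp Require Import ring lra.
Import Order.TTheory GRing.Theory Num.Theory.
Import numFieldNormedType.Exports.
Local Open Scope classical_set_scope.
Local Open Scope ring_scope.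
Set Implicit Arguments.
Unset Strict Implicit.
Unset Printing Implicit Defensive.

(** Write E for the spectral measure of X, P0, P-, P+ and Q for its values on
    Omega0, Omega-, Omega+ and on the complement of Omega, e for the norm of
    X' - X, d1 for the distance from Omega0 to the complement of Omega, and d2
    for the distance from Omega- to Omega+.

    Let G be a spectral projection of X' on an interval that sticks out of Omega0
    by d1 / 2 on both sides.  It commutes with all
    operators that commute with X', hence with B', so that
      [F, B] = [F - G, B] - [G, B' - B].
    The last commutator has norm at most that of B' - B, because G - 1/2 has
    norm 1/2 ([commutator_projection]).  It remains to find F = F- + P0 + F+
    with F- below P-, F+ below P+, and F close to G in norm.

    Two operators whose spectra are separated barely see each other: if L and P
    are spectral projections of self-adjoint Y1 and Y2 for sets at distance d,
    one of them inside an interval that the other avoids, then the norm of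
    L N P is at most that of (Y1 N - N Y2) / d ([sylvester]).  With N = 1 and
    the pair X, X' this bounds (1 - G) P0 and G Q by 2 e / d1
    ([window_estimates]); with N = G and X on both sides it bounds P+ G P- by
    e / d2, as [X, G] = [X - X', G] ([gap_bound]).  So G almost commutes with
    P- and with P+.  The compression P- G P- is then almost a projection, and
    cutting its spectrum at 1/2 yields F- ([compression_cut]); F+ is found in
    the same way.  Adding up the distances, F is within 16 e / d1 + 3 e / d2 of
    G ([projection_near_window]), and twice this is
      32 e / d1 + 6 e / d2 <= (24 / d1 + max (16 / d1, 32 / d2)) e.
    When Omega0 is empty, Omega is the line, d1 = 0 or d2 = 0, the choice F = 0,
    F = 1 or F = P0 is good enough ([band_exists]).

    Membership in the algebra and S-symmetry of these projections rest on one
    construction.  For S-symmetric self-adjoint Y in the algebra, call T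
    admissible when it is in the algebra, S-symmetric, and commutes with
    everything that commutes with Y.  Admissible operators commute with each
    other, so linear symmetry maps fix their products whether they preserve or
    reverse the order of factors; and they are closed under strong limits,
    since the algebra is weakly closed and the symmetry maps are weakly
    continuous.  Strong limits of monotone sequences give |Y|
    ([absolute_value_exists]), then the projection onto the orthogonal of the
    kernel of |Y| + Y, which is the spectral projection of Y on the positive
    half-line ([positive_cut_exists]).  The projections of X on half-lines,
    given by its spectral measure, coincide with cuts of X - s and s - X, and
    those on intervals follow by Boolean operations ([bicomm_set_interval]).

    All estimates use the real inner product Re <u, v>, for which self-adjoint
    operators are symmetric; identities between vectors become identities
    between real numbers, and the order is total. *)

(** * The real inner product space underlying a complex Hilbert space *)

Section RealStructure.
Context {R : realType} {H : hilbertType R}.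
Local Notation C := R[i].
Implicit Types (u v w : H) (r : R) (T U : H -> H).

Definition nrm u : R := complex.Re `|u|.
Definition rip u v : R := complex.Re (inner u v).
Definition rsc r u : H := (r%:C)%C *: u.

Lemma nrmE u : `|u| = (nrm u)%:C%C.
Proof. by rewrite /nrm RRe_real // normr_real. Qed.

Lemma nrm_ge0 u : 0 <= nrm u.
Proof. by have := normr_ge0 u; rewrite nrmE lecR. Qed.

Lemma nrm0 : nrm (0 : H) = 0.
Proof. by rewrite /nrm normr0. Qed.

Lemma nrm_eq0 u : nrm u = 0 -> u = 0.
Proof. by move=> h; apply/normr0_eq0; rewrite nrmE h. Qed.

Lemma nrmD u v : nrm (u + v) <= nrm u + nrm v.
Proof. by rewrite -lecR rmorphD /= -!nrmE ler_normD. Qed.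

Lemma nrmN u : nrm (- u) = nrm u.
Proof. by rewrite /nrm normrN. Qed.

Lemma nrmB u v : nrm (u - v) <= nrm u + nrm v.
Proof. by rewrite -(nrmN v) nrmD. Qed.

Lemma nrmZ r u : nrm (rsc r u) = `|r| * nrm u.
Proof.
rewrite /nrm /rsc normrZ nrmE normc_def /= expr0n addr0 sqrtr_sqr.
by rewrite mul0r subr0.
Qed.

Lemma ripDl u v w : rip (u + v) w = rip u w + rip v w.
Proof. by rewrite /rip linearDl raddfD. Qed.
Lemma ripNl u w : rip (- u) w = - rip u w.
Proof. by rewrite /rip linearNl raddfN. Qed.
Lemma ripBl u v w : rip (u - v) w = rip u w - rip v w.
Proof. by rewrite ripDl ripNl. Qed.
Lemma ripZl r u w : rip (rsc r u) w = r * rip u w.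
Proof. rewrite /rip /rsc linearZl_LR /=; case: (inner u w) => a b /=; by rewrite mul0r subr0. Qed.

Lemma rip_sym u v : rip u v = rip v u.
Proof.
rewrite /rip; have := @hermitian_subproof _ _ _ _ inner u v => ->.
have Re_conj (z : C) : complex.Re z^* = complex.Re z by case: z.
by rewrite expr0 mul1r Re_conj.
Qed.

Lemma ripDr u v w : rip u (v + w) = rip u v + rip u w.
Proof. by rewrite !(rip_sym u) ripDl. Qed.
Lemma ripNr u w : rip u (- w) = - rip u w.
Proof. by rewrite !(rip_sym u) ripNl. Qed.
Lemma ripBr u v w : rip u (v - w) = rip u v - rip u w.
Proof. by rewrite !(rip_sym u) ripBl. Qed.
Lemma ripZr r u w : rip u (rsc r w) = r * rip u w.
Proof. by rewrite !(rip_sym u) ripZl. Qed.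
Lemma rip0l w : rip 0 w = 0.
Proof. by rewrite -(subrr 0) ripBl subrr. Qed.
Lemma rip0r w : rip w 0 = 0.
Proof. by rewrite rip_sym rip0l. Qed.

Lemma rip_nrm u : rip u u = nrm u ^+ 2.
Proof. by rewrite /rip inner_norm nrmE -rmorphXn. Qed.

Lemma rip_ge0 u : 0 <= rip u u.
Proof. by rewrite rip_nrm sqr_ge0. Qed.

Lemma rip_eq0 u : rip u u = 0 -> u = 0.
Proof. by rewrite rip_nrm => /eqP; rewrite sqrf_eq0 => /eqP/nrm_eq0. Qed.

Lemma rip_ext u v : (forall w, rip u w = rip v w) -> u = v.
Proof.
by move=> h; apply/eqP; rewrite -subr_eq0; apply/eqP/rip_eq0; rewrite ripBl h subrr.
Qed.

Lemma nrm_le u c : 0 <= c -> rip u u <= c ^+ 2 -> nrm u <= c.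
Proof. by move=> c0; rewrite rip_nrm ler_sqr ?nnegrE ?nrm_ge0. Qed.

Lemma nrm_mono u v : rip u u <= rip v v -> nrm u <= nrm v.
Proof. by move=> h; apply: nrm_le; rewrite ?nrm_ge0 // -rip_nrm. Qed.

End RealStructure.

(** Equality of vectors is tested against an arbitrary vector, which turns linear
    identities in H into ring identities in R. *)
Ltac vec := by apply: rip_ext => ?; rewrite ?(ripDl, ripNl, ripZl, rip0l); ring.

(** * Norm convergence of vectors and weak convergence of operators *)

Section Convergence.
Context {R : realType} {H : hilbertType R}.
Local Notation C := R[i].
Implicit Types (u v w l : H) (r : R) (T U : H -> H) (x : nat -> H).

Definition tends x l :=
  forall e : R, 0 < e -> exists N, forall n, (N <= n)%N -> nrm (x n - l) <= e.

Lemma tends_uniq x l l' : tends x l -> tends x l' -> l = l'.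
Proof.
move=> xl xl'; apply/eqP; rewrite -subr_eq0; apply/eqP/nrm_eq0/eqP.
rewrite eq_le nrm_ge0 andbT; apply/ler_addgt0Pl => e e0.
have e2 : 0 < e / 2 by rewrite divr_gt0.
have [N1 h1] := xl _ e2; have [N2 h2] := xl' _ e2.
have {}h1 := h1 _ (leq_maxl N1 N2); have {}h2 := h2 _ (leq_maxr N1 N2).
have -> : l - l' = (x (maxn N1 N2) - l') - (x (maxn N1 N2) - l) by vec.
by apply: le_trans (nrmB _ _) _; lra.
Qed.

Lemma cauchy_tends x :
  (forall e : R, 0 < e -> exists N, forall m n, (N <= m)%N -> (m <= n)%N ->
     nrm (x m - x n) <= e) ->
  exists l, tends x l.
Proof.
move=> hx.
have cx : cauchy (x @ \oo).
  apply/cauchy_exP => e e0.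
  have [N hN] : exists N, forall m n, (N <= m)%N -> (m <= n)%N ->
      nrm (x m - x n) <= complex.Re e / 2.
    apply: hx; apply: divr_gt0 => //.
    by move: e0; rewrite ltcE => /andP[].
  exists (x N); exists N => //= n Nn.
  rewrite -ball_normE /= nrmE.
  move: e0; rewrite !ltcE /= => /andP[/eqP -> e0].
  rewrite eqxx /=; apply: le_lt_trans (hN _ _ _ Nn) _ => //; lra.
have /cvg_ex[l xl] : cvg (x @ \oo) by apply: cauchy_cvg.
exists l => e e0.
have /cvgrPdist_le/(_ (e%:C)%C) := xl.
rewrite ltcR => /(_ e0)[N _ hN]; exists N => n /hN /=.
by rewrite nrmE lecR -nrmN opprB.
Qed.

Lemma nrm_Re_inner u v : `|complex.Re (inner u v)| <= nrm u * nrm v.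
Proof.
rewrite -[complex.Re _]/(rip u v).
have h (r : R) : 0 <= r ^+ 2 * rip u u + r * (2 * rip u v) + rip v v.
  have := rip_ge0 (rsc r u + v).
  by rewrite !(ripDl, ripDr, ripZl, ripZr) (rip_sym v u) => /le_trans; apply; lra.
have [u0|/eqP u0] := eqVneq (nrm u) 0.
  by rewrite (nrm_eq0 u0) rip0l nrm0 mul0r normr0.
rewrite -ler_sqr ?nnegrE ?mulr_ge0 ?nrm_ge0 ?normr_ge0 //.
rewrite exprMn -!rip_nrm real_normK ?num_real //.
have uu : 0 < rip u u.
  by rewrite lt_neqAle rip_ge0 andbT eq_sym rip_nrm sqrf_eq0; apply/eqP.
have := h (- rip u v / rip u u).
have -> : (- rip u v / rip u u) ^+ 2 * rip u u +
    - rip u v / rip u u * (2 * rip u v) + rip v v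
  = (rip u u * rip v v - rip u v ^+ 2) / rip u u.
  by field; rewrite gt_eqF.
by rewrite pmulr_lge0 ?invr_gt0 // subr_ge0.
Qed.

Lemma inner_Im u v : complex.Im (inner u v) = complex.Re (inner u ('i%C *: v)).
Proof.
rewrite linearZr_LR /=.
have Re_conj (z : C) : complex.Re (Num.conj ('i : C)%C * z) = complex.Im z.
  by case: z => a b /=; rewrite mul0r sub0r mulN1r opprK.
by rewrite Re_conj.
Qed.

(** The factor 2 comes from bounding the real and the imaginary part separately
    by the real Cauchy-Schwarz inequality; any constant would do for continuity. *)
Lemma inner_norm_le u v : complex.Re `|inner u v| <= 2 * (nrm u * nrm v).
Proof.
have h1 := nrm_Re_inner u v.
have h2 : `|complex.Im (inner u v)| <= nrm u * nrm v.
  rewrite inner_Im; apply: le_trans (nrm_Re_inner _ _) _.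
  have -> : nrm ('i%C *: v) = nrm v.
    by rewrite /nrm normrZ normc_def /= expr0n /= add0r expr1n sqrtr1 mul1r.
  by [].
have : `|inner u v| <= (`|complex.Re (inner u v)|)%:C%C + (`|complex.Im (inner u v)|)%:C%C.
  case: (inner u v) => a b; rewrite normc_def -rmorphD lecR /=.
  rewrite -[leRHS]ger0_norm ?addr_ge0 // -sqrtr_sqr ler_wsqrtr //.
  rewrite sqrrD !real_normK ?num_real // -addrA lerD2l addrC lerDl.
  by rewrite mulrn_wge0 ?mulr_ge0.
rewrite lecE => /andP[_] /= h3; apply: le_trans h3 _; lra.
Qed.

Local Notation wot := (initial_topology (@matrix_coefs R H)).

(** Matrix coefficients are continuous in the vectors T u, so strong convergence
    implies weak convergence. *)
Lemma wot_cvg (T_ : nat -> H -> H) T :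
  (forall u, tends (T_ ^~ u) (T u)) ->
  (T_ : nat -> wot) @ \oo --> (T : wot).
Proof.
move=> hT.
have h : (fun n => matrix_coefs (T_ n)) @ \oo --> (matrix_coefs T : {ptws H * H -> C^o}).
  apply/pointwise_cvgP => -[u v].
  apply/(@cvgrPdist_le _ C^o) => e; rewrite ltcE /= => /andP[/eqP e0 e1].
  have hv : 0 < 2 * (nrm v + 1) by rewrite mulr_gt0 ?ltr_wpDl ?nrm_ge0.
  have [N hN] := hT u _ (divr_gt0 e1 hv).
  exists N => // n /hN /= {}hN.
  rewrite /matrix_coefs /= -linearBl /=.
  suff : complex.Re `|inner (T u - T_ n u) v| <= complex.Re e.
    move=> h; rewrite lecE; apply/andP; split=> //.
    by rewrite e0 normc_def.
  apply: le_trans (inner_norm_le _ _) _.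
  rewrite -nrmN opprB.
  have := ler_wpM2r (ltW hv) hN; rewrite divfK ?gt_eqF // => h'; apply: le_trans h'.
  have := nrm_ge0 (T_ n u - T u); have := nrm_ge0 v; nra.
move=> B [W [[V oV <-] VT] sB].
have /h [N _ hN] : nbhs (matrix_coefs T : {ptws H * H -> C^o}) V.
  exact: open_nbhs_nbhs.
by exists N => // n /hN /= hn; apply: sB.
Qed.

Lemma wot_closure (A : set (H -> H)) (T_ : nat -> H -> H) T :
  (forall n, A (T_ n)) -> (forall u, tends (T_ ^~ u) (T u)) ->
  closure (A : set wot) T.
Proof.
move=> AT /wot_cvg h B /h [N _ hN].
by exists (T_ N); split; [apply: AT | apply: hN => /=].
Qed.

(** A weakly continuous map fixes limits of fixed points because matrix
    coefficients separate operators. *)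
Lemma wot_fixed (A : set (H -> H)) phi (T_ : nat -> H -> H) T :
  weakly_continuous A phi -> (forall n, A (T_ n)) -> A T ->
  (forall n, phi (T_ n) = T_ n) -> (forall u, tends (T_ ^~ u) (T u)) ->
  phi T = T.
Proof.
move=> cphi AT_ AT phiT hT.
have cT := wot_cvg hT.
have h1 : (T_ : nat -> wot) @ \oo --> (phi T : wot).
  move=> B hB; have := cphi (T : wot) B hB.
  rewrite /nbhs /= -nbhs_subspace_in // => /cT [N _ hN].
  exists N => // n /hN /= hn.
  by rewrite -phiT; exact: (hn (AT_ n)).
have h2 (T' : H -> H) : (T_ : nat -> wot) @ \oo --> (T' : wot) ->
    forall u v, (fun n => inner (T_ n u) v : C^o) @ \oo --> (inner (T' u) v : C^o).
  move=> h u v.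
  have : (fun n => matrix_coefs (T_ n)) @ \oo --> (matrix_coefs T' : {ptws H * H -> C^o}).
    by move=> B /(@initial_continuous _ _ (@matrix_coefs R H) (T' : wot)) /h.
  by move=> /pointwise_cvgP /(_ (u, v)).
apply/funext => u; apply: rip_ext => v; rewrite /rip; congr complex.Re.
by apply: (cvg_unique _ (h2 _ h1 u v) (h2 _ cT u v)); exact: norm_hausdorff.
Qed.

End Convergence.

(** * Bounded operators, positivity and strong limits *)

Section Operators.
Context {R : realType} {H : hilbertType R}.
Local Notation C := R[i].
Implicit Types (u v w l : H) (r c : R) (T U P : H -> H) (x y : nat -> H).

Definition bnd T c := forall u, nrm (T u) <= c * nrm u.
Definition sym T := forall u v, rip (T u) v = rip u (T v).
Definition comm T U := forall v, T (U v) = U (T v).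

Section Linear.
Variables (T : H -> H) (bT : bounded_op T).

Lemma opD u v : T (u + v) = T u + T v.
Proof. by have := bT.1 1 u v; rewrite !scale1r. Qed.

Lemma op0 : T 0 = 0.
Proof. by have := opD 0 0; rewrite addr0 => /(congr1 (fun z => z - T 0)); rewrite subrr addrK. Qed.

Lemma opZ (k : C) u : T (k *: u) = k *: T u.
Proof. by have := bT.1 k u 0; rewrite op0 !addr0. Qed.

Lemma opR r u : T (rsc r u) = rsc r (T u).
Proof. exact: opZ. Qed.

Lemma opN u : T (- u) = - T u.
Proof. by rewrite -scaleN1r opZ scaleN1r. Qed.

Lemma opB u v : T (u - v) = T u - T v.
Proof. by rewrite opD opN. Qed.
End Linear.

Definition pack_linear (f : H -> H) (lf : linear f) : {linear H -> H} :=
  HB.pack f (GRing.isLinear.Build _ _ _ _ _ lf).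

Lemma nrmCZ (k : C) u : nrm (k *: u) = complex.Re `|k| * nrm u.
Proof.
rewrite /nrm normrZ nrmE normc_def /=.
by rewrite mul0r subr0.
Qed.

Lemma bounded_opP T : bounded_op T <-> linear T /\ exists2 c, 0 <= c & bnd T c.
Proof.
split=> [[lT cT]|[lT [c c0 hc]]]; split=> //.
  have /linear_boundedP : bounded_near (pack_linear lT) (nbhs 0).
    by apply/linear_bounded_continuous.
  move=> /pinfty_ex_gt0[M]; rewrite ltcE /= => /andP[/eqP iM M0] hM.
  exists (complex.Re M); first exact: ltW.
  have ReM (z : C) r : complex.Re (z * (r%:C)%C) = complex.Re z * r.
    by case: z => a b /=; rewrite mulr0 subr0.
  by move=> u; have := hM u; rewrite !nrmE lecE ReM => /andP[_].
apply/(linear_bounded_continuous (pack_linear lT)).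
apply/linear_boundedP; exists (c%:C)%C; split.
  by apply: ger0_real; rewrite lecR.
move=> r cr u /=; apply: (@le_trans _ _ (c%:C%C * `|u|)); last first.
  by apply: ler_wpM2r => //; apply: ltW.
by rewrite !nrmE -rmorphM lecR hc.
Qed.

Lemma sym_self_adjoint T : bounded_op T -> self_adjoint T <-> sym T.
Proof.
move=> bT; split=> [h u v|h u v]; first by rewrite /rip h.
apply/eqP; rewrite eq_complex; apply/andP; split; apply/eqP.
  exact: h.
by rewrite !inner_Im -(opZ bT); exact: h.
Qed.

(** The diagonal coefficients of a symmetric operator are real, so the partial
    order of the complex numbers reduces to the order of real parts. *)
Lemma op_le_rip T U : bounded_op T -> bounded_op U -> sym T -> sym U ->
  (forall u, rip (T u) u <= rip (U u) u) -> op_le T U.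
Proof.
move=> bT bU sT sU h u; rewrite lecE; apply/andP; split; last exact: h.
have im (V : H -> H) : bounded_op V -> sym V -> complex.Im (inner (V u) u) = 0.
  move=> bV sV; rewrite inner_Im -[complex.Re _]/(rip _ _) sV opZ //.
  rewrite rip_sym /rip linearZl_LR /=.
  have e : complex.Im (inner (V u) u) = - complex.Im (inner (V u) u).
    rewrite [in LHS]inner_Im -[complex.Re _]/(rip _ _) sV opZ // rip_sym.
    by rewrite /rip linearZl_LR /=; case: (inner _ _) => a b /=; rewrite mul0r mul1r sub0r.
  have e0 : complex.Im (inner (V u) u) = 0 by lra.
  by move: e0; case: (inner _ _) => a b /= ->; rewrite mulr0 mul0r subr0.
by rewrite !im.
Qed.

(** Polarization, in the form used to compare two expressions in operators through
    their quadratic forms. *)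
Lemma quadratic_form_eq0 T : (forall u v, T (u + v) = T u + T v) -> sym T ->
  (forall u, rip (T u) u = 0) -> forall u, T u = 0.
Proof.
move=> addT sT h u; apply: rip_ext => w; rewrite rip0l.
have := h (u + w); rewrite addT !(ripDl, ripDr) !h (sT w u) (rip_sym w).
lra.
Qed.

Lemma nrm_rip u v : rip u v <= nrm u * nrm v.
Proof. exact: le_trans (ler_norm _) (nrm_Re_inner u v). Qed.

Lemma bop_id : bounded_op (fun v : H => v).
Proof. by apply/bounded_opP; split=> //; exists 1 => // u; rewrite mul1r. Qed.

Lemma bop_comp T U : bounded_op T -> bounded_op U -> bounded_op (fun v => T (U v)).
Proof.
move=> bT bU; have [lT [c c0 hc]] := (bounded_opP T).1 bT.
have [lU [d d0 hd]] := (bounded_opP U).1 bU; apply/bounded_opP; split.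
  by move=> k u v; rewrite lU lT.
exists (c * d); first exact: mulr_ge0.
by move=> u; apply: le_trans (hc _) _; rewrite -mulrA ler_wpM2l.
Qed.

Lemma bop_lin r T U : bounded_op T -> bounded_op U ->
  bounded_op (fun v => rsc r (T v) + U v).
Proof.
move=> bT bU; have [lT [c c0 hc]] := (bounded_opP T).1 bT.
have [lU [d d0 hd]] := (bounded_opP U).1 bU; apply/bounded_opP; split.
  move=> k u v; rewrite lU lT /rsc !scalerDr !scalerA mulrC addrACA.
  by [].
exists (`|r| * c + d); first by rewrite addr_ge0 ?mulr_ge0.
move=> u; apply: le_trans (nrmD _ _) _; rewrite nrmZ mulrDl lerD // -mulrA.
by rewrite ler_wpM2l.
Qed.

Lemma bop_sub T U : bounded_op T -> bounded_op U -> bounded_op (fun v => T v - U v).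
Proof.
move=> bT bU; have -> : (fun v => T v - U v) = (fun v => rsc (-1) (U v) + T v).
  by apply/funext => v; vec.
exact: bop_lin.
Qed.

(** For 0 <= T <= M this is T^2 <= M T: expand <T w, w> >= 0 at w = v - T v / M.
    The bounds are required only along the vectors v - s T v and T v, which
    makes the lemma usable on an invariant subspace. *)
Lemma positive_square_le T v M : bounded_op T -> sym T -> 0 <= M ->
  (forall s, 0 <= rip (T (v - rsc s (T v))) (v - rsc s (T v))) ->
  rip (T (T v)) (T v) <= M * rip (T v) (T v) ->
  rip (T v) (T v) <= M * rip (T v) v.
Proof.
move=> bT sT M0 h hM.
have {}h s : 0 <= rip (T v) v - 2 * s * rip (T v) (T v) + s ^+ 2 * rip (T (T v)) (T v).
  have := h s; rewrite opB // opR // !(ripBl, ripBr, ripZl, ripZr) (sT (T v) v).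
  by move=> /le_trans; apply; lra.
(* for M = 0 the quadratic in s is at most affine, so a large s refutes T v != 0 *)
have [M00|Mn] := eqVneq M 0.
  rewrite M00 !mul0r in hM *; rewrite leNgt; apply/negP => b0.
  have := h ((rip (T v) v + 1) / (2 * rip (T v) (T v))).
  have -> : 2 * ((rip (T v) v + 1) / (2 * rip (T v) (T v))) * rip (T v) (T v)
    = rip (T v) v + 1 by field; rewrite gt_eqF.
  set s := (_ / _); have := mulr_ge0_le0 (sqr_ge0 s) hM; lra.
have Mp : 0 < M by rewrite lt_neqAle eq_sym Mn.
have := h M^-1.
have : M^-1 ^+ 2 * rip (T (T v)) (T v) <= M^-1 * rip (T v) (T v).
  have -> : M^-1 * rip (T v) (T v) = M^-1 ^+ 2 * (M * rip (T v) (T v)).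
    by field.
  by rewrite ler_wpM2l // sqr_ge0.
move=> h1 h2.
have : M^-1 * rip (T v) (T v) <= rip (T v) v by lra.
by rewrite ler_pdivrMl.
Qed.

(** Closedness of linear inequalities between inner products; both directions
    of an equality follow from it by changing signs. *)
Lemma tends_ge x y l m u v c : tends x l -> tends y m ->
  (forall n, 0 <= rip (x n) u + rip (y n) v + c) -> 0 <= rip l u + rip m v + c.
Proof.
move=> xl ym h; apply/ler_addgt0Pr => e e0.
have hp w : 0 < nrm w + 1 by have := nrm_ge0 w; lra.
have e2 : 0 < e / 2 by lra.
have [N1 h1] := xl _ (divr_gt0 e2 (hp u)).
have [N2 h2] := ym _ (divr_gt0 e2 (hp v)).
have {}h1 := h1 _ (leq_maxl N1 N2); have {}h2 := h2 _ (leq_maxr N1 N2).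
set n := maxn N1 N2 in h1 h2.
have aux z w : nrm z <= e / 2 / (nrm w + 1) -> rip z w <= e / 2.
  move=> hz; apply: le_trans (nrm_rip _ _) _.
  have := ler_wpM2r (ltW (hp w)) hz; rewrite divfK ?gt_eqF //.
  by apply: le_trans; rewrite ler_wpM2l ?nrm_ge0 //; lra.
have := aux _ _ h1; have := aux _ _ h2; have := h n.
rewrite !ripBl; lra.
Qed.

Lemma tends_cst l : tends (fun=> l) l.
Proof. by move=> e e0; exists 0%N => n _; rewrite subrr nrm0 ltW. Qed.

Lemma tends_rip_eq x y l m u v : tends x l -> tends y m ->
  (forall n, rip (x n) u = rip (y n) v) -> rip l u = rip m v.
Proof.
move=> xl ym h; apply/eqP; rewrite eq_le; apply/andP; split.
- have := @tends_ge x y l m (- u) v 0 xl ym; rewrite ripNr => H'.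
  by rewrite -subr_ge0 addrC -[leRHS]addr0; apply: H' => n; rewrite ripNr h; lra.
- have := @tends_ge x y l m u (- v) 0 xl ym; rewrite ripNr => H'.
  by rewrite -subr_ge0 -[leRHS]addr0; apply: H' => n; rewrite ripNr h; lra.
Qed.

Lemma tends_op T x l : bounded_op T -> tends x l -> tends (T \o x) (T l).
Proof.
move=> bT xl e e0; have [_ [c c0 hc]] := (bounded_opP T).1 bT.
have cp : 0 < c + 1 by lra.
have [N hN] := xl _ (divr_gt0 e0 cp); exists N => n /hN {}hN /=.
rewrite -opB //; apply: le_trans (hc _) _.
have := ler_wpM2r (ltW cp) hN; rewrite divfK ?gt_eqF // => h; apply: le_trans h.
by rewrite mulrC ler_wpM2l ?nrm_ge0 //; lra.
Qed.

Lemma tendsD x y l m : tends x l -> tends y m -> tends (fun n => x n + y n) (l + m).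
Proof.
move=> xl ym e e0; have e2 : 0 < e / 2 by lra.
have [N1 h1] := xl _ e2; have [N2 h2] := ym _ e2; exists (maxn N1 N2) => n.
rewrite geq_max => /andP[/h1 {}h1 /h2 {}h2].
have -> : x n + y n - (l + m) = (x n - l) + (y n - m) by vec.
apply: le_trans (nrmD _ _) _; lra.
Qed.

Lemma tendsZ (k : C) x l : tends x l -> tends (fun n => k *: x n) (k *: l).
Proof.
move=> xl e e0; have k0 : 0 <= complex.Re `|k|.
  by have := normr_ge0 k; rewrite lecE => /andP[].
have cp : 0 < complex.Re `|k| + 1 by lra.
have [N hN] := xl _ (divr_gt0 e0 cp); exists N => n /hN {}hN /=.
rewrite -scalerBr nrmCZ.
have := ler_wpM2r (ltW cp) hN; rewrite divfK ?gt_eqF // => h; apply: le_trans h.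
by rewrite mulrC ler_wpM2l ?nrm_ge0 //; lra.
Qed.

Lemma tends_nrm x l c : tends x l -> (forall n, nrm (x n) <= c) -> nrm l <= c.
Proof.
move=> xl h; apply/ler_addgt0Pr => e e0; have [N hN] := xl _ e0.
have := hN N (leqnn _); have := h N.
have := nrmB (x N) (x N - l).
by rewrite subKr; lra.
Qed.

(** Multiplication is jointly strongly continuous on bounded sets. *)
Lemma tends_comp (T_ : nat -> H -> H) T c x l : (forall n, bounded_op (T_ n)) ->
  (forall n, bnd (T_ n) c) -> (forall u, tends (T_ ^~ u) (T u)) -> tends x l ->
  tends (fun n => T_ n (x n)) (T l).
Proof.
move=> bT bc hT xl e e0; have e2 : 0 < e / 2 by lra.
have cp : 0 < `|c| + 1 by have := normr_ge0 c; lra.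
have [N1 h1] := xl _ (divr_gt0 e2 cp); have [N2 h2] := hT l _ e2.
exists (maxn N1 N2) => n; rewrite geq_max => /andP[/h1 {}h1 /h2 {}h2].
have -> : T_ n (x n) - T l = T_ n (x n - l) + (T_ n l - T l).
  rewrite (opB (bT n)); vec.
apply: le_trans (nrmD _ _) _.
have := bc n (x n - l).
have := ler_wpM2r (ltW cp) h1; rewrite divfK ?gt_eqF //.
have := nrm_ge0 (x n - l); have := ler_norm c; nra.
Qed.

(** For an increasing sequence of operators T_n with 0 <= T_m - T_n <= 1 the
    square of |T_m v - T_n v| is at most a_m - a_n with a_n = <T_n v, v>, and
    the real sequence a_n converges. *)
Lemma monotone_tends x (a : nat -> R) M :
  (forall n, a n <= a n.+1) -> (forall n, a n <= M) ->
  (forall m n, (n <= m)%N -> rip (x m - x n) (x m - x n) <= a m - a n) ->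
  exists l, tends x l.
Proof.
move=> am aM hx; apply: cauchy_tends => e e0.
have nda : nondecreasing_seq a by apply/nondecreasing_seqP.
have ca : cvgn a.
  by apply: nondecreasing_is_cvgn => //; exists M => _ [n _ <-].
have e2 : 0 < e ^+ 2 by rewrite exprn_gt0.
have /cvgrPdist_le/(_ _ e2)[N _ hN] := ca.
exists N => n m Nn nm; rewrite -nrmN opprB.
apply: nrm_le; first exact: ltW.
apply: le_trans (hx _ _ nm) _.
have := hN n Nn; have := nondecreasing_cvgn_le nda ca m.
rewrite /= => h1 h2; have := le_trans (ler_norm _) h2; lra.
Qed.

Lemma sym_lim (T_ : nat -> H -> H) T : (forall n, sym (T_ n)) ->
  (forall u, tends (T_ ^~ u) (T u)) -> sym T.
Proof.
move=> sT lT u v; rewrite [RHS]rip_sym.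
by apply: (tends_rip_eq (lT u) (lT v)) => n; rewrite sT rip_sym.
Qed.

Lemma strong_lim (T_ : nat -> H -> H) c : 0 <= c ->
  (forall n, bounded_op (T_ n)) -> (forall n, bnd (T_ n) c) ->
  (forall u, exists l, tends (T_ ^~ u) l) ->
  exists T, [/\ bounded_op T, bnd T c & forall u, tends (T_ ^~ u) (T u)].
Proof.
move=> c0 bT bc /choice[T hT].
have Tc : bnd T c by move=> u; apply: tends_nrm (hT u) _ => n; exact: bc.
exists T; split=> //; apply/bounded_opP; split; last by exists c.
move=> k u v; apply: tends_uniq (hT _) _.
have := tendsD (tendsZ k (hT u)) (hT v).
congr (tends _ _); apply/funext => n; exact/esym/(bT n).1.
Qed.

Lemma positive_contraction T : bounded_op T -> sym T ->
  (forall v, 0 <= rip (T v) v <= rip v v) ->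
  (forall v, rip (T v) (T v) <= rip (T v) v) /\ bnd T 1.
Proof.
move=> bT sT h.
have h1 v : rip (T v) (T v) <= rip (T v) v.
  rewrite -[leRHS]mul1r; apply: positive_square_le => // [s|].
    by case/andP: (h (v - rsc s (T v))).
  by rewrite mul1r; case/andP: (h (T v)).
split=> // v; rewrite mul1r; apply: nrm_mono; apply: le_trans (h1 v) _.
by case/andP: (h v).
Qed.

Lemma tends_shift x l : tends x l -> tends (fun n => x n.+1) l.
Proof. by move=> xl e /xl[N hN]; exists N => n Nn; apply/hN/leqW. Qed.

End Operators.

(** * S-symmetric operators and bicommutants *)

Section Algebra.
Context {R : realType} {H : hilbertType R}.
Variables (A : set (H -> H)) (S : set ((H -> H) -> (H -> H))).
Hypothesis vA : von_neumann_algebra A.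
Hypothesis HS : forall phi, S phi -> linear_symmetry A phi /\ weakly_continuous A phi.
Implicit Types (u v w l : H) (r c : R) (T U P Y : H -> H) (x y : nat -> H).

Definition fixed_op T := A T /\ S_symmetric S T.

Lemma A_bop T : A T -> bounded_op T. Proof. exact: vna_bounded. Qed.
Lemma fixed_op_bop T : fixed_op T -> bounded_op T. Proof. by case=> /A_bop. Qed.

Lemma fixed_op_id : fixed_op (fun v => v).
Proof. by split; [exact: vna_id | move=> phi /HS[/lsym_id]]. Qed.

Lemma fixed_op_lin r T U : fixed_op T -> fixed_op U -> fixed_op (fun v => rsc r (T v) + U v).
Proof.
move=> [AT ST] [AU SU]; split; first exact: (vna_linear vA (r%:C)%C AT AU).
move=> phi Sphi; have [h _] := HS Sphi.
by have := lsym_linear h (r%:C)%C AT AU; rewrite (ST _ Sphi) (SU _ Sphi).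
Qed.

Lemma fixed_op_ext T U : T =1 U -> fixed_op T -> fixed_op U.
Proof. by move=> /funext ->. Qed.

Lemma fixed_op_0 : fixed_op (fun=> 0).
Proof. apply: fixed_op_ext (fixed_op_lin (-1) fixed_op_id fixed_op_id) => v. vec. Qed.

Lemma fixed_op_add T U : fixed_op T -> fixed_op U -> fixed_op (fun v => T v + U v).
Proof. move=> hT hU; apply: fixed_op_ext (fixed_op_lin 1 hT hU) => v. vec. Qed.

(** Commutation makes the product insensitive to whether the symmetry map
    preserves or reverses the order of factors. *)
Lemma fixed_op_comp T U : fixed_op T -> fixed_op U -> comm T U -> fixed_op (fun v => T (U v)).
Proof.
move=> [AT ST] [AU SU] cTU; split; first exact: (vna_comp vA AT AU).
move=> phi Sphi; have [h _] := HS Sphi.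
have [h1|h1] := lsym_mult h; have := h1 _ _ AT AU; rewrite (ST _ Sphi) (SU _ Sphi) => -> //.
by apply/funext => v; rewrite /= cTU.
Qed.

(** The word P T P reads the same in both directions, so that multiplicative and
    anti-multiplicative maps treat it alike. *)
Lemma fixed_op_compress P T : fixed_op P -> fixed_op T -> fixed_op (fun v => P (T (P v))).
Proof.
move=> [AP SP] [AT ST].
have ATP := vna_comp vA AT AP; have APT := vna_comp vA AP AT.
have AQ : A (P \o (T \o P)) := vna_comp vA AP ATP.
split => // phi Sphi; have [h _] := HS Sphi.
rewrite -[RHS]/(P \o (T \o P)) -[X in phi X]/(P \o (T \o P)).
by have [h1|h1] := lsym_mult h; rewrite h1 // h1 // (ST _ Sphi) (SP _ Sphi).
Qed.

(** Strong limits are weak limits: the algebra is weakly closed and the symmetry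
    maps are weakly continuous on it. *)
Lemma fixed_op_lim (T_ : nat -> H -> H) T : (forall n, fixed_op (T_ n)) -> bounded_op T ->
  (forall u, tends (T_ ^~ u) (T u)) -> fixed_op T.
Proof.
move=> hT bT lT.
have AT : A T.
  apply: (vna_closed vA); split => //.
  by apply: wot_closure lT => n; case: (hT n).
split => // phi Sphi; have [_ h] := HS Sphi.
apply: (wot_fixed h _ AT _ lT) => n; first by case: (hT n).
by case: (hT n) => _; apply.
Qed.

(** The S-symmetric part of the bicommutant of Y inside the algebra; when Y
    belongs to it, any two of its elements commute. *)
Definition bicomm Y T := fixed_op T /\ forall U, bounded_op U -> comm U Y -> comm U T.

Lemma bicomm_fixed Y T : bicomm Y T -> fixed_op T. Proof. by case. Qed.
Lemma bicomm_bop Y T : bicomm Y T -> bounded_op T. Proof. by case=> /fixed_op_bop. Qed.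

Lemma bicomm_self Y : fixed_op Y -> bicomm Y Y. Proof. by []. Qed.
Lemma bicomm_id Y : bicomm Y (fun v => v). Proof. by split; [exact: fixed_op_id | ]. Qed.
Lemma bicomm_ext Y T U : T =1 U -> bicomm Y T -> bicomm Y U. Proof. by move=> /funext ->. Qed.
Lemma bicomm_lin Y r T U : bicomm Y T -> bicomm Y U -> bicomm Y (fun v => rsc r (T v) + U v).
Proof.
move=> [sT cT] [sU cU]; split; first exact: fixed_op_lin.
by move=> V bV cV v; rewrite (opD bV) (opR bV) cT // cU.
Qed.
Lemma bicomm_0 Y : bicomm Y (fun=> 0).
Proof. by split; [exact: fixed_op_0 | move=> U bU _ v; rewrite op0]. Qed.
Lemma bicomm_sub Y T U : bicomm Y T -> bicomm Y U -> bicomm Y (fun v => T v - U v).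
Proof. move=> hT hU; apply: bicomm_ext (bicomm_lin (-1) hU hT) => v. vec. Qed.
Lemma bicomm_add Y T U : bicomm Y T -> bicomm Y U -> bicomm Y (fun v => T v + U v).
Proof. move=> hT hU; apply: bicomm_ext (bicomm_lin 1 hT hU) => v. vec. Qed.
Lemma bicomm_rsc Y r T : bicomm Y T -> bicomm Y (fun v => rsc r (T v)).
Proof. move=> hT; apply: bicomm_ext (bicomm_lin r hT (bicomm_0 Y)) => v. vec. Qed.

Lemma comm_sym T U : comm T U -> comm U T. Proof. by move=> h v; rewrite h. Qed.

Lemma bicomm_commY Y T : fixed_op Y -> bicomm Y T -> comm T Y.
Proof. by move=> /fixed_op_bop bY [_ h]; apply/comm_sym/h. Qed.

Lemma bicomm_comm Y T U : fixed_op Y -> bicomm Y T -> bicomm Y U -> comm T U.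
Proof. move=> sY kT [_ h]; apply: h; [exact: bicomm_bop kT | exact: bicomm_commY]. Qed.

Lemma bicomm_comp Y T U : fixed_op Y -> bicomm Y T -> bicomm Y U -> bicomm Y (fun v => T (U v)).
Proof.
move=> sY kT kU; split.
  by apply: fixed_op_comp (bicomm_comm sY kT kU); [case: kT | case: kU].
by move=> V bV cV v; rewrite (kT.2 V) // (kU.2 V).
Qed.

Lemma bicomm_trans Y T U : bicomm Y T -> bicomm T U -> bicomm Y U.
Proof. by move=> [_ h] [sU h']; split=> // V bV cV; apply: h' => //; apply: h. Qed.

Lemma bicomm_lim Y (T_ : nat -> H -> H) T : (forall n, bicomm Y (T_ n)) -> bounded_op T ->
  (forall u, tends (T_ ^~ u) (T u)) -> bicomm Y T.
Proof.
move=> kT bT lT; split; first by apply: fixed_op_lim lT => // n; case: (kT n).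
move=> U bU cU v; apply: tends_uniq (lT (U v)).
have -> : T_ ^~ (U v) = U \o (T_ ^~ v).
  by apply/funext => n /=; rewrite (kT n).2.
exact: tends_op.
Qed.

Section Powers.
Variables (W : H -> H).
Hypotheses (sW : fixed_op W) (symW : sym W) (posW : forall v, 0 <= rip (W v) v <= rip v v).

Let bW := fixed_op_bop sW.
Let W_ n := iter n W.

(** The powers of W with 0 <= W <= 1 decrease to the projection Q onto the
    vectors fixed by W.  Even powers are squares and odd powers are W sandwiched
    between equal powers, so positivity and monotonicity of the sequence reduce
    to 0 <= W <= 1 and W^2 <= W. *)
Lemma powers_converge : exists Q, [/\ bicomm W Q, sym Q & forall v, Q (Q v) = Q v] /\
  [/\ (forall v, W (Q v) = Q v), (forall v, W v = v -> Q v = v) &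
  forall T, bounded_op T -> (forall v, T (W v) = T v) -> forall v, T (Q v) = T v].
Proof.
have [h1 bW1] := positive_contraction bW symW posW.
have kW n : bicomm W (W_ n).
  elim: n => [|n IH]; first exact: bicomm_id.
  exact: (bicomm_comp sW (bicomm_self sW) IH).
have sWn n : sym (W_ n).
  elim: n => [//|n IH] u v; rewrite /W_ [in RHS]iterSr /= symW; exact: IH.
have bWn n : bnd (W_ n) 1.
  elim: n => [|n IH] v; first by rewrite mul1r.
  by apply: le_trans (bW1 _) _; rewrite mul1r; exact: IH.
have even n v : rip (W_ n.*2 v) v = rip (W_ n v) (W_ n v).
  by rewrite -addnn /W_ iterD -/(W_ n) sWn.
have odd n v : rip (W_ n.*2.+1 v) v = rip (W (W_ n v)) (W_ n v).
  rewrite -addnn /W_ iterS iterD -/(W_ n) symW sWn [RHS]symW.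
  by rewrite /W_ -iterSr.
have pWn n v : 0 <= rip (W_ n v) v.
  rewrite -[n]odd_double_half; case: (ssrnat.odd n).
    by rewrite add1n odd; case/andP: (posW (W_ n./2 v)).
  by rewrite add0n even rip_ge0.
have dWn n v : rip (W_ n.+1 v) v <= rip (W_ n v) v.
  rewrite -[n]odd_double_half; case: (ssrnat.odd n); last first.
    by rewrite add0n odd even; case/andP: (posW (W_ n./2 v)).
  rewrite add1n odd -doubleS even; exact: h1.
have dW m n v : (n <= m)%N -> rip (W_ m v) v <= rip (W_ n v) v.
  move=> /subnK <-; elim: (m - n)%N => [//|k IH].
  by rewrite addSn; apply: le_trans IH.
have lW v : exists l, tends (W_ ^~ v) l.
  apply: (@monotone_tends _ _ _ (fun n => - rip (W_ n v) v) 0).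
  - by move=> n; rewrite lerN2.
  - by move=> n; rewrite oppr_le0.
  - move=> m n nm.
    have kD : bicomm W (fun v => W_ n v - W_ m v) by apply: bicomm_sub.
    have [||hD _] := positive_contraction (bicomm_bop kD).
    + by move=> u w; rewrite ripBl ripBr !sWn.
    + move=> u; rewrite ripBl subr_ge0 dW //=.
      have := pWn m u; have : rip (W_ n u) u <= rip u u by exact: (dW n 0%N).
      lra.
    + have := hD v; rewrite !(ripBl, ripBr); lra.
have [Q [bQ _ lQ]] := strong_lim ler01 (fun n => bicomm_bop (kW n)) bWn lW.
have WQ v : W (Q v) = Q v.
  have t1 := tends_op bW (lQ v).
  exact: tends_uniq t1 (tends_shift (lQ v)).
have fixQ v : W v = v -> Q v = v.
  move=> hv; apply: tends_uniq (lQ v) _.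
  suff -> : W_ ^~ v = fun=> v by exact: tends_cst.
  by apply/funext => n; rewrite /W_ iter_fix.
exists Q; split; split=> //.
- exact: bicomm_lim kW bQ lQ.
- exact: sym_lim sWn lQ.
- by move=> v; apply: fixQ.
move=> T bT hT v; apply: tends_uniq (tends_op bT (lQ v)) _.
suff -> : T \o (W_ ^~ v) = fun=> T v by exact: tends_cst.
by apply/funext => n /=; rewrite /W_; elim: n => [//|n IH] /=; rewrite hT.
Qed.

End Powers.
End Algebra.

(** * Absolute values and spectral cuts *)

Section Cut.
Context {R : realType} {H : hilbertType R}.
Variables (A : set (H -> H)) (S : set ((H -> H) -> (H -> H))).
Hypothesis vA : von_neumann_algebra A.
Hypothesis HS : forall phi, S phi -> linear_symmetry A phi /\ weakly_continuous A phi.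
Implicit Types (u v w l : H) (r c : R) (T U P Y : H -> H) (x y : nat -> H).
Local Notation fixed_op := (fixed_op A S).
Local Notation bicomm := (bicomm A S).

Section Positive.
Variables (Y B : H -> H).
Hypotheses (sY : fixed_op Y) (kB : bicomm Y B) (symB : sym B) (posB : forall v, 0 <= rip (B v) v).

(** Polynomials in B with nonnegative coefficients, given by generators so that
    closure under composition and positivity are proved by induction. *)
Inductive nonneg_poly : (H -> H) -> Prop :=
| nonneg_poly_0 : nonneg_poly (fun=> 0)
| nonneg_poly_id : nonneg_poly (fun v => v)
| nonneg_poly_mul T : nonneg_poly T -> nonneg_poly (fun v => B (T v))
| nonneg_poly_lin r T U : 0 <= r -> nonneg_poly T -> nonneg_poly U ->
    nonneg_poly (fun v => rsc r (T v) + U v).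

Lemma nonneg_poly_ext T U : T =1 U -> nonneg_poly T -> nonneg_poly U.
Proof. by move=> /funext ->. Qed.

Lemma nonneg_poly_comp T U : nonneg_poly T -> nonneg_poly U -> nonneg_poly (fun v => T (U v)).
Proof.
move=> nT nU; elim: nT => {T} [||T _ IH|r T V r0 _ IHT _ IHV] //.
- exact: nonneg_poly_0.
- exact: nonneg_poly_mul IH.
- exact: nonneg_poly_lin.
Qed.

Lemma nonneg_poly_add T U : nonneg_poly T -> nonneg_poly U -> nonneg_poly (fun v => T v + U v).
Proof. by move=> nT nU; apply: nonneg_poly_ext (nonneg_poly_lin ler01 nT nU) => v; vec. Qed.

Lemma nonneg_poly_rsc r T : 0 <= r -> nonneg_poly T -> nonneg_poly (fun v => rsc r (T v)).
Proof. by move=> r0 nT; apply: nonneg_poly_ext (nonneg_poly_lin r0 nT nonneg_poly_0) => v; vec. Qed.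

Lemma nonneg_poly_bicomm T : nonneg_poly T -> bicomm Y T.
Proof.
elim=> {T} [||T _ IH|r T V r0 _ IHT _ IHV].
- exact: bicomm_0.
- exact: bicomm_id.
- exact: bicomm_comp.
- exact: bicomm_lin.
Qed.

Lemma nonneg_poly_sym T : nonneg_poly T -> sym T.
Proof.
elim=> {T} [u v|//|T nT IH u v|r T V r0 _ IHT _ IHV u v].
- by rewrite rip0l rip0r.
- by rewrite symB IH (bicomm_comm vA sY (nonneg_poly_bicomm nT) kB).
- by rewrite ripDl ripDr ripZl ripZr IHT IHV.
Qed.

(** The claim for B T is carried along the induction, because
    <B B T v, v> = <T B v, B v>. *)
Lemma nonneg_poly_pos T : nonneg_poly T -> forall v, 0 <= rip (T v) v.
Proof.
move=> nT; suff h : forall v, 0 <= rip (T v) v /\ 0 <= rip (B (T v)) v.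
  by move=> v; case: (h v).
have bB := bicomm_bop vA kB.
elim: nT => {T} [||T nT IH|r T V r0 nT IHT nV IHV] v.
- by rewrite (op0 bB) rip0l.
- by split; [exact: rip_ge0 | exact: posB].
- split; first by case: (IH v).
  by rewrite symB -(bicomm_comm vA sY (nonneg_poly_bicomm nT) kB); case: (IH (B v)).
have [t1 t2] := IHT v; have [v1 v2] := IHV v.
by rewrite (opD bB) (opR bB) !ripDl !ripZl !addr_ge0 // mulr_ge0.
Qed.

End Positive.

(** With B = 1 - Y^2, the iteration S' = (B + S^2) / 2 started at 0 produces
    polynomials in B with nonnegative coefficients that increase and stay below
    1; the limit Q satisfies 2 Q = B + Q^2, so (1 - Q)^2 = Y^2. *)
Lemma absolute_value_exists Y : fixed_op Y -> sym Y -> bnd Y 1 ->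
  exists M, [/\ bicomm Y M, sym M, (forall v, 0 <= rip (M v) v) & forall v, M (M v) = Y (Y v)].
Proof.
move=> sY symY Y1; have bY := fixed_op_bop vA sY.
pose B v := v - Y (Y v).
have kB : bicomm Y B.
  apply: (bicomm_sub vA HS); first exact: bicomm_id.
  by apply: (bicomm_comp vA HS) => //; exact: bicomm_self.
have bB := bicomm_bop vA kB.
have symB : sym B by move=> u v; rewrite /B ripBl ripBr !symY.
have hB v : 0 <= rip (B v) v <= rip v v.
  rewrite /B ripBl symY subr_ge0 lerBlDr lerDl rip_ge0 andbT.
  by rewrite !rip_nrm ler_sqr ?nnegrE ?nrm_ge0 //; have := Y1 v; rewrite mul1r.
have posB v : 0 <= rip (B v) v by case/andP: (hB v).
have [_ B1] := positive_contraction bB symB hB.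
pose fix S_ n : H -> H := if n is n'.+1 then fun v => rsc 2^-1 (B v + S_ n' (S_ n' v))
  else fun=> 0.
have half0 : 0 <= 2^-1 :> R by rewrite invr_ge0.
have nS n : nonneg_poly B (S_ n).
  elim: n => [|n IH]; first exact: nonneg_poly_0.
  apply: nonneg_poly_rsc => //; apply: nonneg_poly_add; last exact: nonneg_poly_comp.
  exact/nonneg_poly_mul/nonneg_poly_id.
have kS n : bicomm Y (S_ n) by exact: nonneg_poly_bicomm (nS n).
have bS n := bicomm_bop vA (kS n).
have nD n : nonneg_poly B (fun v => S_ n.+1 v - S_ n v).
  elim: n => [|n IH].
    have nB := nonneg_poly_mul (nonneg_poly_id B).
    by apply: nonneg_poly_ext (nonneg_poly_rsc half0 nB) => v /=; vec.
  have nSS := nonneg_poly_add (nS n.+1) (nS n).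
  apply: nonneg_poly_ext (nonneg_poly_rsc half0 (nonneg_poly_comp IH nSS)) => v.
  rewrite (opD (bS n.+1)) (opD (bS n)) (bicomm_comm vA sY (kS n.+1) (kS n)).
  rewrite [S_ n.+2 v]/(rsc 2^-1 (B v + S_ n.+1 (S_ n.+1 v))).
  rewrite [in X in _ - X](_ : S_ n.+1 v = rsc 2^-1 (B v + S_ n (S_ n v))) //.
  vec.
(* S_(n + k) - S_n telescopes *)
have nDk n k : nonneg_poly B (fun v => S_ (k + n)%N v - S_ n v).
  elim: k => [|k IH].
    by apply: nonneg_poly_ext (nonneg_poly_0 B) => v; rewrite subrr.
  by apply: nonneg_poly_ext (nonneg_poly_add (nD (k + n)%N) IH) => v; rewrite addSn; vec.
have S1 n : bnd (S_ n) 1.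
  elim: n => [|n IH] v; first by rewrite nrm0 mul1r nrm_ge0.
  rewrite /= nrmZ ger0_norm //.
  have := nrmD (B v) (S_ n (S_ n v)); have := B1 v; have := IH v; have := IH (S_ n v).
  lra.
have Sle n v : rip (S_ n v) v <= rip v v.
  apply: le_trans (nrm_rip _ _) _; rewrite rip_nrm expr2 ler_wpM2r ?nrm_ge0 //.
  by have := S1 n v; rewrite mul1r.
have posS n := nonneg_poly_pos sY kB symB posB (nS n).
have lS v : exists l, tends (S_ ^~ v) l.
  apply: (@monotone_tends _ _ _ (fun n => rip (S_ n v) v) (rip v v)).
  - by move=> n; rewrite -subr_ge0 -ripBl (nonneg_poly_pos sY kB symB posB (nD n)).
  - by move=> n.
  - move=> m n nm; have nmn := nDk n (m - n)%N; rewrite subnK // in nmn.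
    have pD := nonneg_poly_pos sY kB symB posB nmn.
    have [||hD _] := positive_contraction (bicomm_bop vA (nonneg_poly_bicomm sY kB nmn)).
    + exact: (nonneg_poly_sym sY kB symB nmn).
    + move=> u; rewrite pD /=; rewrite ripBl; have := Sle m u; have := posS n u; lra.
    + by have := hD v; rewrite !ripBl.
have [Q [bQ Q1 lQ]] := strong_lim ler01 bS S1 lS.
have eqQ v : Q v = rsc 2^-1 (B v + Q (Q v)).
  apply: tends_uniq (tends_shift (lQ v)) _.
  apply/tendsZ/tendsD; first exact: tends_cst.
  exact: tends_comp lQ (lQ v).
exists (fun v => v - Q v); split.
- by apply: bicomm_sub => //; [exact: bicomm_id | exact: bicomm_lim kS bQ lQ].
- have symQ : sym Q by apply: sym_lim lQ => n; exact: (nonneg_poly_sym sY kB symB (nS n)).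
  by move=> u v; rewrite ripBl ripBr symQ.
- move=> v; rewrite ripBl subr_ge0.
  apply: le_trans (nrm_rip _ _) _; rewrite rip_nrm expr2 ler_wpM2r ?nrm_ge0 //.
  by have := Q1 v; rewrite mul1r.
move=> v; rewrite (opB bQ).
have -> : Q (Q v) = rsc 2 (Q v) - B v.
  apply: rip_ext => w; have /(congr1 (rip ^~ w)) := eqQ v.
  by rewrite !(ripBl, ripDl, ripZl); lra.
rewrite /B; vec.
Qed.

(** P is the spectral projection of Y on the open half-line of positive numbers.
    The last clause, Y being definite on the range of P, excludes the kernel of
    Y and makes P unique. *)
Definition positive_cut Y P :=
  [/\ bicomm Y P, sym P & forall v, P (P v) = P v] /\
  [/\ (forall v, P v = v -> 0 <= rip (Y v) v),
      (forall v, P v = 0 -> rip (Y v) v <= 0) &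
      (forall v, P v = v -> rip (Y v) v = 0 -> v = 0)].

(** With M = |Y| and N = M + Y one has (M - Y) N = 0, so the projection Q onto
    the kernel of N has M - Y vanishing on its complement: there Y = M >= 0,
    whereas Y = - M <= 0 on the range of Q.  The projection Q is the limit of
    powers of 1 - N^2 / 4; squaring N avoids proving N >= 0 first. *)
Lemma positive_cut_contraction Y : fixed_op Y -> sym Y -> bnd Y 1 -> exists P, positive_cut Y P.
Proof.
move=> sY symY Y1; have bY := fixed_op_bop vA sY.
have [M [kM symM posM MM]] := absolute_value_exists sY symY Y1.
have bM := bicomm_bop vA kM.
have M1 : bnd M 1.
  by move=> v; rewrite mul1r; apply: nrm_mono; rewrite symM MM -symY !rip_nrm
    ler_sqr ?nnegrE ?nrm_ge0 //; have := Y1 v; rewrite mul1r.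
have cMY := bicomm_commY vA sY kM.
pose N v := M v + Y v.
have kN : bicomm Y N by exact: bicomm_add.
have bN := bicomm_bop vA kN.
have symN : sym N by move=> u v; rewrite /N ripDl ripDr symM symY.
pose Z v := rsc 4^-1 (N (N v)).
have kZ : bicomm Y Z by apply: bicomm_rsc => //; apply: bicomm_comp.
pose W v := v - Z v.
have kW : bicomm Y W by apply: bicomm_sub => //; apply: bicomm_id.
have symW : sym W by move=> u v; rewrite /W /Z ripBl ripBr ripZl ripZr !symN.
have posW v : 0 <= rip (W v) v <= rip v v.
  rewrite /W ripBl /Z ripZl symN.
  have : nrm (N v) <= 2 * nrm v.
    apply: le_trans (nrmD _ _) _; have := M1 v; have := Y1 v; lra.
  have := nrm_ge0 (N v); have := nrm_ge0 v; rewrite !rip_nrm => h1 h2 h3.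
  apply/andP; split; nra.
have [Q [[kQ symQ QQ] [WQ fixQ absQ]]] := powers_converge vA HS (bicomm_fixed kW) symW posW.
have bQ := bicomm_bop vA kQ.
have DQ v : M (Q v) - Y (Q v) = M v - Y v.
  have bD : bounded_op (fun v => M v - Y v).
    exact: (bicomm_bop vA (bicomm_sub vA HS kM (bicomm_self sY))).
  apply: (absQ _ bD) => {}v.
  have DN u : M (N u) - Y (N u) = 0.
    by rewrite /N (opD bM) (opD bY) MM cMY; vec.
  have -> : M (W v) - Y (W v) = (M v - Y v) - rsc 4^-1 (M (N (N v)) - Y (N (N v))).
    by rewrite /W /Z (opB bM) (opB bY) (opR bM) (opR bY); vec.
  by rewrite DN; vec.
have NQ v : N (Q v) = 0.
  have : Z (Q v) = 0.
    have := WQ v; rewrite /W => /(congr1 (fun z => Q v - z)); rewrite subKr => ->.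
    by rewrite subrr.
  move=> /(congr1 (rip ^~ (Q v))); rewrite rip0l /Z ripZl symN => /eqP.
  by rewrite mulf_eq0 invr_eq0 pnatr_eq0 /= => /eqP /rip_eq0.
have P1 v : v - Q v = v -> Q v = 0.
  by move=> /(congr1 (fun z => v - z)); rewrite subKr subrr.
have eqMY v : Q v = 0 -> M v = Y v.
  move=> h; have := DQ v; rewrite h (op0 bM) (op0 bY) subrr => /esym/eqP.
  by rewrite subr_eq0 => /eqP.
exists (fun v => v - Q v); split; split.
- by apply: bicomm_sub => //; [exact: bicomm_id | exact: bicomm_trans kW kQ].
- by move=> u v; rewrite ripBl ripBr symQ.
- by move=> v; rewrite (opB bQ) QQ subrr subr0.
- by move=> v /P1 /eqMY <-.
- move=> v /eqP; rewrite subr_eq0 => /eqP hv.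
  have /(congr1 (rip ^~ v)) := NQ v; rewrite -hv ripDl rip0l.
  by have := posM v; lra.
move=> v /P1 Q0; have MY := eqMY _ Q0; rewrite -MY => Mv.
have M0 : M v = 0.
  apply: rip_eq0; apply: le_anti; rewrite rip_ge0 andbT -Mv.
  have [|h _] := positive_contraction bM symM; last exact: h.
  move=> u; rewrite posM /=; apply: le_trans (nrm_rip _ _) _.
  by rewrite rip_nrm expr2 ler_wpM2r ?nrm_ge0 //; have := M1 u; rewrite mul1r.
rewrite -Q0 fixQ // /W /Z /N -MY M0 addr0 (op0 bM) (op0 bY) addr0; vec.
Qed.

Lemma positive_cut_exists Y : fixed_op Y -> sym Y -> exists P, positive_cut Y P.
Proof.
move=> sY symY; have bY := fixed_op_bop vA sY.
have [_ [c c0 Yc]] := (bounded_opP Y).1 bY.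
have d1 : 0 < c + 1 by lra.
have d0 : 0 < (c + 1)^-1 by rewrite invr_gt0.
pose Y' v := rsc (c + 1)^-1 (Y v).
have kY' : bicomm Y Y' by apply: bicomm_rsc => //; exact: bicomm_self.
have [||P [[kP symP PP] [h1 h2 h3]]] := @positive_cut_contraction Y' (bicomm_fixed kY').
- by move=> u v; rewrite /Y' ripZl ripZr symY.
- move=> v; rewrite /Y' nrmZ gtr0_norm // ler_pdivrMl // mul1r.
  by have := Yc v; have := nrm_ge0 v; lra.
exists P; split; split => //.
- exact: bicomm_trans kY' kP.
- by move=> v /h1; rewrite ripZl pmulr_rge0.
- by move=> v /h2; rewrite ripZl pmulr_rle0.
- by move=> v hv Yv; apply: h3 => //; rewrite ripZl Yv mulr0.
Qed.

End Cut.

(** * Integrals against a finite measure carried by a set *)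

Section Measure.
Context {R : realType}.
Variable mu : {measure set R -> \bar R}.
Hypothesis mufin : (mu setT < +oo)%E.

Lemma integrable_constant (c : R) : mu.-integrable setT (EFin \o (fun=> c)).
Proof.
apply/integrableP; split; first exact: measurable_cst.
rewrite integral_cst //=; apply: lte_mul_pinfty => //.
Qed.

Lemma Rintegral_ge0_on (D : set R) (f : R -> R) : measurable D -> mu (~` D) = 0%E ->
  mu.-integrable setT (EFin \o f) -> (forall x, D x -> 0 <= f x) ->
  0 <= Rintegral mu setT f.
Proof.
move=> mD mD0 fi f0.
rewrite /Rintegral (negligible_integral (measurableC mD) measurableT fi mD0).
by rewrite setTD setCK; apply: Rintegral_ge0.
Qed.

Lemma Rintegral_gt0_on (D : set R) (f : R -> R) : measurable D -> mu (~` D) = 0%E ->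
  mu.-integrable setT (EFin \o f) -> (forall x, D x -> 0 < f x) ->
  Rintegral mu setT f <= 0 -> mu D = 0%E.
Proof.
move=> mD mD0 fi f0.
have fD : mu.-integrable D (EFin \o f) by exact: integrableS fi.
rewrite /Rintegral (negligible_integral (measurableC mD) measurableT fi mD0).
rewrite setTD setCK => h.
have h0 : (\int[mu]_(x in D) (f x)%:E)%E = 0%E.
  have fin := integrable_fin_num mD fD.
  rewrite -[LHS](fineK fin); congr EFin; apply: le_anti; rewrite h /=.
  by apply: Rintegral_ge0 => x /f0/ltW.
have /(ae_eq_integral_abs mu mD (measurable_int _ fD)) :
    (\int[mu]_(x in D) `|(EFin \o f) x|)%E = 0%E.
  rewrite -h0; apply: eq_integral => x /set_mem /f0 fx /=.
  by rewrite ger0_norm // ltW.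
case=> N [mN N0 sN]; apply: (subset_measure0 mD mN _ N0) => x Dx.
by apply: sN => /= /(_ Dx) [fx0]; have := f0 x Dx; rewrite fx0 ltxx.
Qed.

End Measure.

(** * Spectral measures *)

Section Spectral.
Context {R : realType} {H : hilbertType R}.
Variables (X : H -> H) (E : set R -> H -> H).
Hypotheses (bX : bounded_op X) (symX : sym X) (hE : is_spectral_measure X E).
Implicit Types (u v w l : H) (r c : R) (D : set R).

Lemma specm_bop D : measurable D -> bounded_op (E D).
Proof. by case: hE => h _ _ _ /h[]. Qed.
Lemma specm_sym D : measurable D -> sym (E D).
Proof.
move=> mD; have bD := specm_bop mD; apply/sym_self_adjoint => //.
by case: hE => h _ _ _; case: (h _ mD).
Qed.
Lemma specm_T v : E setT v = v.
Proof. by case: hE => _ -> _ _. Qed.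
Lemma specm_I D1 D2 v : measurable D1 -> measurable D2 -> E (D1 `&` D2) v = E D1 (E D2 v).
Proof. by case: hE => _ _ h _ m1 m2; rewrite h. Qed.
Lemma specm_idem D v : measurable D -> E D (E D v) = E D v.
Proof. by move=> mD; rewrite -specm_I // setIid. Qed.

Lemma specm_mu u : exists mu : {measure set R -> \bar R},
      [/\ forall D, measurable D -> mu D = (rip (E D u) u)%:E,
          mu.-integrable setT (EFin \o id), (mu setT < +oo)%E,
          fine (mu setT) = rip u u
        & rip (X u) u = Rintegral mu setT (fun x : R => x)].
Proof.
case: hE => _ _ _ /(_ u)[mu [h1 h2 h3]]; exists mu; split => //.
- by rewrite h1 // ltry.
- by rewrite h1 //= specm_T.
- by rewrite /rip h3.
Qed.

(** Additivity of the scalar measures gives equality of quadratic forms, hence of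
    operators by polarization. *)
Lemma specm_U D1 D2 v : measurable D1 -> measurable D2 -> D1 `&` D2 = set0 ->
  E (D1 `|` D2) v = E D1 v + E D2 v.
Proof.
move=> m1 m2 d12.
have m12 : measurable (D1 `|` D2) by exact: measurableU.
apply/eqP; rewrite -subr_eq0; apply/eqP; move: v.
apply: quadratic_form_eq0.
- by move=> u v; rewrite !(opD (specm_bop _)) //; vec.
- by move=> u v; rewrite ripBl ripDl ripBr ripDr !specm_sym.
- move=> u; have [mu [h1 _ _ _ _]] := specm_mu u.
  have : mu (D1 `|` D2) = (mu D1 + mu D2)%E by rewrite measureU.
  rewrite !h1 // => -[].
  by rewrite ripBl ripDl => ->; rewrite subrr.
Qed.

Lemma specm_C D v : measurable D -> E (~` D) v = v - E D v.
Proof.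
move=> mD; have := @specm_U D (~` D) v mD (measurableC mD) (setICr D).
by rewrite setUCr specm_T => {2}->; rewrite addrC addKr.
Qed.

Lemma specm_0 v : E set0 v = 0.
Proof. by rewrite -setCT specm_C // specm_T subrr. Qed.

Lemma specm_supp D u mu : measurable D -> E D u = u ->
  (forall D, measurable D -> mu D = (rip (E D u) u)%:E) -> mu (~` D) = 0%E.
Proof.
by move=> mD Du h; rewrite h ?specm_C ?Du ?subrr ?rip0l //; exact: measurableC.
Qed.

Lemma specm_ge D b u : measurable D -> (forall x, D x -> b <= x) -> E D u = u ->
  b * rip u u <= rip (X u) u.
Proof.
move=> mD Db Du; have [mu [h1 h2 h3 h4 ->]] := specm_mu u.
have ic := integrable_constant h3 b.
have : 0 <= Rintegral mu setT (fun x => id x - (fun=> b) x).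
  apply: (Rintegral_ge0_on mD).
  - exact: specm_supp mD Du h1.
  - exact: (integrableB _ h2 ic).
  - by move=> x /Db; rewrite subr_ge0.
by rewrite RintegralB // Rintegral_cst // h4 subr_ge0.
Qed.

Lemma specm_le D b u : measurable D -> (forall x, D x -> x <= b) -> E D u = u ->
  rip (X u) u <= b * rip u u.
Proof.
move=> mD Db Du; have [mu [h1 h2 h3 h4 ->]] := specm_mu u.
have ic := integrable_constant h3 b.
have : 0 <= Rintegral mu setT (fun x => (fun=> b) x - id x).
  apply: (Rintegral_ge0_on mD).
  - exact: specm_supp mD Du h1.
  - exact: (integrableB _ ic h2).
  - by move=> x /Db; rewrite subr_ge0.
by rewrite RintegralB // Rintegral_cst // h4 subr_ge0.
Qed.

Lemma specm_gt D b u : measurable D -> (forall x, D x -> b < x) -> E D u = u ->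
  rip (X u) u <= b * rip u u -> u = 0.
Proof.
move=> mD Db Du; have [mu [h1 h2 h3 h4 ->]] := specm_mu u => h.
have ic := integrable_constant h3 b.
have : mu D = 0%E.
  apply: (@Rintegral_gt0_on _ _ _ (fun x => id x - (fun=> b) x) mD).
  - exact: specm_supp mD Du h1.
  - exact: (integrableB _ h2 ic).
  - by move=> x /Db; rewrite subr_gt0.
  - by rewrite RintegralB // Rintegral_cst // h4 subr_le0.
by rewrite h1 // Du => -[] /rip_eq0.
Qed.

Lemma specm_lt D b u : measurable D -> (forall x, D x -> x < b) -> E D u = u ->
  b * rip u u <= rip (X u) u -> u = 0.
Proof.
move=> mD Db Du; have [mu [h1 h2 h3 h4 ->]] := specm_mu u => h.
have ic := integrable_constant h3 b.
have : mu D = 0%E.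
  apply: (@Rintegral_gt0_on _ _ _ (fun x => (fun=> b) x - id x) mD).
  - exact: specm_supp mD Du h1.
  - exact: (integrableB _ ic h2).
  - by move=> x /Db; rewrite subr_gt0.
  - by rewrite RintegralB // Rintegral_cst // h4 subr_le0.
by rewrite h1 // Du => -[] /rip_eq0.
Qed.

(** The scalar measure of u is the sum of those of E D u and u - E D u.
    Integrating, the quadratic form of X splits along the range and the kernel
    of E D, and by polarization X preserves both. *)
Lemma specm_comm D : measurable D -> comm (E D) X.
Proof.
move=> mD; have bE := specm_bop mD; have sE := specm_sym mD.
have h v : X v - (E D (X (E D v)) + (X (v - E D v) - E D (X (v - E D v)))) = 0.
  move: v; apply: quadratic_form_eq0.
  - by move=> u v; rewrite !(opB bE, opB bX, opD bE, opD bX); vec.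
  - move=> u v; rewrite !(opB bE, opB bX) !(ripBl, ripBr, ripDl, ripDr).
    by rewrite !(sE, symX); ring.
  move=> u; have [mu [a1 a2 a3 a4 a5]] := specm_mu u.
  have [mu1 [b1 b2 b3 b4 b5]] := specm_mu (E D u).
  have [mu2 [c1 c2 c3 c4 c5]] := specm_mu (u - E D u).
  have : rip (X u) u = rip (X (E D u)) (E D u) + rip (X (u - E D u)) (u - E D u).
    rewrite a5 b5 c5 /Rintegral -fineD; try exact: integrable_fin_num.
    rewrite -integral_measure_add //; congr fine; apply: eq_measure_integral.
    move=> D' mD' _; rewrite -[RHS]/(measure_add mu1 mu2 D') measure_addE.
    rewrite b1 // c1 //.
    rewrite a1 // -EFinD; congr EFin.
    have cE : comm (E D') (E D) by move=> w; rewrite -!specm_I // setIC.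
    rewrite (opB (specm_bop mD')) cE -sE -!cE specm_idem //.
    by rewrite !(ripBl, ripBr) (cE u) !sE specm_idem //; ring.
  by rewrite ripBl ripDl !sE ripBl sE => ->; rewrite ripBr; ring.
move=> v.
have h' w : E D w = w -> E D (X w) = X w.
  move=> hw; have := h w; rewrite hw subrr (op0 bX) (op0 bE) subrr addr0.
  by move=> /eqP; rewrite subr_eq0 => /eqP ->; rewrite specm_idem.
have h'' w : E D w = 0 -> E D (X w) = 0.
  move=> hw; have := h w; rewrite hw (op0 bX) (op0 bE) subr0 add0r.
  by rewrite subKr.
have -> : X v = X (E D v) + X (v - E D v) by rewrite (opB bX); vec.
rewrite (opD bE) h' ?specm_idem // h'' ?addr0 //.
by rewrite (opB bE) specm_idem // subrr.
Qed.

End Spectral.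

(** * Spectral projections on intervals lie in the bicommutant *)

Section SpectralK.
Context {R : realType} {H : hilbertType R}.
Variables (A : set (H -> H)) (S : set ((H -> H) -> (H -> H))).
Hypothesis vA : von_neumann_algebra A.
Hypothesis HS : forall phi, S phi -> linear_symmetry A phi /\ weakly_continuous A phi.
Implicit Types (u v w l : H) (r c s : R) (T U P Y : H -> H) (D : set R).
Local Notation fixed_op := (fixed_op A S).
Local Notation bicomm := (bicomm A S).
Variables (X : H -> H) (E : set R -> H -> H).
Hypotheses (sX : fixed_op X) (symX : sym X) (hE : is_spectral_measure X E).
Let bX := fixed_op_bop vA sX.

(** Uniqueness of spectral cuts: a projection E D that commutes with Y, with
    Y <= 0 on its kernel and Y > 0 on its range, is the cut of Y. *)
Lemma specm_ray Y D : bicomm X Y -> sym Y -> measurable D -> comm (E D) Y ->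
  (forall z, E D z = 0 -> rip (Y z) z <= 0) ->
  (forall z, E D z = z -> rip (Y z) z <= 0 -> z = 0) -> bicomm X (E D).
Proof.
move=> kY symY mD cEY h0 h1; have bE := specm_bop hE mD.
have [P [[kP symP PP] [P1 P2 P3]]] := positive_cut_exists vA HS (bicomm_fixed kY) symY.
have bP := bicomm_bop vA kP.
have cEP : comm (E D) P by apply: kP.2.
suff eq v : E D v = P v by apply: bicomm_ext (bicomm_trans kY kP).
have e1 : P v - E D (P v) = 0.
  set z := (X in X = 0).
  have Pz : P z = z by rewrite /z (opB bP) -cEP PP.
  have Ez : E D z = 0 by rewrite /z (opB bE) (specm_idem hE) // subrr.
  by apply: P3 => //; apply: le_anti; rewrite h0 //= P1.
have e2 : E D v - E D (P v) = 0.
  set z := (X in X = 0).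
  have Pz : P z = 0 by rewrite /z (opB bP) -!cEP PP subrr.
  have Ez : E D z = z by rewrite /z (opB bE) !(specm_idem hE).
  by apply: h1 => //; apply: P2.
by move/eqP: e1; move/eqP: e2; rewrite !subr_eq0 => /eqP -> /eqP.
Qed.

Definition bicomm_set D := measurable D /\ bicomm X (E D).

Lemma bicomm_set_T : bicomm_set setT.
Proof. by split => //; apply: bicomm_ext (bicomm_id vA HS X) => v; rewrite (specm_T hE). Qed.

Lemma bicomm_set_C D : bicomm_set D -> bicomm_set (~` D).
Proof.
move=> [mD kD]; split; first exact: measurableC.
by apply: bicomm_ext (bicomm_sub vA HS (bicomm_id vA HS X) kD) => v; rewrite (specm_C hE).
Qed.

Lemma bicomm_set_I D1 D2 : bicomm_set D1 -> bicomm_set D2 -> bicomm_set (D1 `&` D2).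
Proof.
move=> [m1 k1] [m2 k2]; split; first exact: measurableI.
by apply: bicomm_ext (bicomm_comp vA HS sX k1 k2) => v; rewrite (specm_I hE).
Qed.

Lemma bicomm_set_gt s : bicomm_set [set x | s < x].
Proof.
have mD : measurable [set x | s < x].
  by rewrite -set_itvoy; exact: measurable_itv.
split=> //; pose Y v := X v - rsc s v.
have cE := specm_comm bX symX hE mD.
apply: (@specm_ray Y) => //.
- by apply: (bicomm_sub vA HS); [exact: bicomm_self | apply: (bicomm_rsc vA HS); exact: bicomm_id].
- by move=> u v; rewrite /Y ripBl ripBr ripZl ripZr symX.
- by move=> v; rewrite /Y (opB (specm_bop hE mD)) (opR (specm_bop hE mD)) cE.
- move=> z Ez; rewrite /Y ripBl ripZl subr_le0.
  apply: (specm_le hE (measurableC mD)) => [x /= /negP|].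
    by rewrite -leNgt.
  by rewrite (specm_C hE) // Ez subr0.
move=> z Ez; rewrite /Y ripBl ripZl subr_le0.
exact: (specm_gt hE mD).
Qed.

Lemma bicomm_set_lt s : bicomm_set [set x | x < s].
Proof.
have mD : measurable [set x | x < s].
  by rewrite -set_itvNyo; exact: measurable_itv.
split=> //; pose Y v := rsc s v - X v.
have cE := specm_comm bX symX hE mD.
apply: (@specm_ray Y) => //.
- by apply: (bicomm_sub vA HS); [apply: (bicomm_rsc vA HS); exact: bicomm_id | exact: bicomm_self].
- by move=> u v; rewrite /Y ripBl ripBr ripZl ripZr symX.
- by move=> v; rewrite /Y (opB (specm_bop hE mD)) (opR (specm_bop hE mD)) cE.
- move=> z Ez; rewrite /Y ripBl ripZl subr_le0.
  apply: (specm_ge hE (measurableC mD)) => [x /= /negP|].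
    by rewrite -leNgt.
  by rewrite (specm_C hE) // Ez subr0.
move=> z Ez; rewrite /Y ripBl ripZl subr_le0.
exact: (specm_lt hE mD).
Qed.

Lemma bicomm_set_interval D : is_interval D -> bicomm_set D.
Proof.
move=> /is_intervalP ->; case: (Rhull D) => l r.
have -> : [set x | x \in Interval l r] =
    [set x | (l <= BLeft x)%O] `&` [set x | (BRight x <= r)%O] :> set R.
  apply/seteqP; split=> x /=; first by rewrite itv_boundlr => /andP.
  by case=> h1 h2; rewrite itv_boundlr h1 h2.
have NT (D1 D2 : set R) : (forall x, D1 x <-> D2 x) -> bicomm_set D2 -> bicomm_set D1.
  by move=> h; have -> : D1 = D2 by apply/seteqP; split => x /h.
apply: bicomm_set_I.
  case: l => [[] x|[]].
  - apply: NT (bicomm_set_C (bicomm_set_lt x)) => y /=; rewrite bnd_simp.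
    by split=> [h /(lt_le_trans)/(_ h)|/negP]; rewrite ?ltxx // -leNgt.
  - by apply: NT (bicomm_set_gt x) => y /=; rewrite bnd_simp.
  - by apply: NT bicomm_set_T => y.
  - by apply: NT (bicomm_set_C bicomm_set_T) => y /=; split.
case: r => [[] x|[]].
- by apply: NT (bicomm_set_lt x) => y /=; rewrite bnd_simp.
- apply: NT (bicomm_set_C (bicomm_set_gt x)) => y /=; rewrite bnd_simp.
  by split=> [h /(le_lt_trans h)|/negP]; rewrite ?ltxx // -leNgt.
- by apply: NT (bicomm_set_C bicomm_set_T) => y /=; split.
- by apply: NT bicomm_set_T => y.
Qed.

End SpectralK.

(** * Norm estimates for separated spectra *)

Section Estimates.
Context {R : realType} {H : hilbertType R}.
Implicit Types (u v w l : H) (r c s : R) (T U P Y X : H -> H).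

Definition oproj P := [/\ bounded_op P, sym P & forall v, P (P v) = P v].

Lemma oproj_bop P : oproj P -> bounded_op P. Proof. by case. Qed.
Lemma oproj_rip P v : oproj P -> rip (P v) v = rip (P v) (P v).
Proof. by move=> [bP sP PP]; rewrite [RHS]sP PP rip_sym. Qed.

Lemma oproj_split P v : oproj P -> rip v v = rip (P v) (P v) + rip (v - P v) (v - P v).
Proof.
by move=> /(oproj_rip v) e; rewrite !(ripBl, ripBr) (rip_sym v (P v)) e; ring.
Qed.

Lemma oproj_nrm P v : oproj P -> nrm (P v) <= nrm v.
Proof.
move=> hP; apply: nrm_mono; rewrite (oproj_split v hP) lerDl; exact: rip_ge0.
Qed.

Lemma oproj_C P : oproj P -> oproj (fun v => v - P v).
Proof.
move=> [bP sP PP]; split; first exact: bop_sub bop_id bP.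
- by move=> u v; rewrite ripBl ripBr sP.
- by move=> v; rewrite (opB bP) PP subrr subr0.
Qed.

(** On the range of P, T = X - c + r satisfies 0 <= T <= 2 r, so T^2 <= 2 r T,
    which says (X - c)^2 <= r^2. *)
Lemma norm_of_numerical_range X P c r v : bounded_op X -> sym X -> oproj P -> comm P X -> 0 <= r ->
  (forall u, P u = u -> (c - r) * rip u u <= rip (X u) u <= (c + r) * rip u u) ->
  P v = v -> nrm (X v - rsc c v) <= r * nrm v.
Proof.
move=> bX sX hP cPX r0 h Pv; have [bP sP PP] := hP.
pose T u := P (X (P u)) - rsc (c - r) (P u).
have bT : bounded_op T.
  have b0 : bounded_op (fun u => rsc (c - r) (P u) + (P u - P u)).
    exact: bop_lin bP (bop_sub bP bP).
  have -> : T = fun u => P (X (P u)) - (rsc (c - r) (P u) + (P u - P u)).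
    by apply/funext => u; rewrite /T; vec.
  exact: bop_sub (bop_comp bP (bop_comp bX bP)) b0.
have symT : sym T by move=> u w; rewrite /T ripBl ripBr ripZl ripZr !(sP, sX).
have T0 u : 0 <= rip (T u) u.
  have /andP[] := h (P u) (PP u).
  rewrite /T ripBl ripZl (sP (X (P u)) u) (oproj_rip u hP); lra.
have TM u : rip (T u) u <= 2 * r * rip u u.
  have /andP[_] := h (P u) (PP u).
  have : rip (P u) (P u) <= rip u u by rewrite [leRHS](oproj_split u hP) lerDl rip_ge0.
  rewrite /T ripBl ripZl (sP (X (P u)) u) (oproj_rip u hP); nra.
have M0 : 0 <= 2 * r by rewrite mulr_ge0.
have := positive_square_le bT symT M0 (fun s => T0 (v - rsc s (T v))) (TM (T v)).
have -> : T v = X v - rsc c v + rsc r v by rewrite /T Pv cPX Pv; vec.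
rewrite !(ripDl _ (rsc r v)) !(ripDr _ _ (rsc r v)) !ripZl !ripZr.
set D := X v - rsc c v; rewrite (rip_sym v D) => h'.
apply: nrm_le; first by rewrite mulr_ge0 ?nrm_ge0.
rewrite exprMn -rip_nrm; lra.
Qed.

(** Pair (X - c) (v + w) with v - w, which has the same norm as v + w. *)
Lemma norm_lower_bound X c r v w : bounded_op X -> sym X -> rip v w = 0 ->
  (c + r) * rip v v <= rip (X v) v -> rip (X w) w <= (c - r) * rip w w ->
  r * nrm (v + w) <= nrm (X (v + w) - rsc c (v + w)).
Proof.
move=> bX sX vw hv hw.
have h : r * rip (v + w) (v + w) <= rip (X (v + w) - rsc c (v + w)) (v - w).
  rewrite (opD bX) !(ripBl, ripBr, ripDl, ripDr, ripZl) (sX w v) (rip_sym w (X v)).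
  rewrite (rip_sym w v) vw; lra.
have e : nrm (v - w) = nrm (v + w).
  have : nrm (v - w) ^+ 2 = nrm (v + w) ^+ 2.
    by rewrite -!rip_nrm !(ripBl, ripBr, ripDl, ripDr) (rip_sym w v) vw; ring.
  by move/eqP; rewrite eqrXn2 ?nrm_ge0 // => /eqP.
have := le_trans h (nrm_rip _ _); rewrite e rip_nrm expr2 mulrA.
have [n0|n0] := eqVneq (nrm (v + w)) 0; first by move=> _; rewrite n0 mulr0 nrm_ge0.
by rewrite ler_pM2r // lt_neqAle eq_sym n0 nrm_ge0.
Qed.

Lemma opnormP T : bounded_op T -> exists z, [/\ opnorm T = z%:E, 0 <= z, bnd T z
  & forall c, 0 <= c -> bnd T c -> z <= c].
Proof.
move=> bT; have [_ [c0 c0_ge0 Tc0]] := (bounded_opP T).1 bT.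
have ub c : 0 <= c -> bnd T c -> (opnorm T <= c%:E)%E.
  move=> c_ge0 Tc; apply: ge_ereal_sup => _ [u u1 <-]; rewrite lee_fin.
  apply: le_trans (Tc u) _; rewrite -[leRHS]mulr1 ler_wpM2l //.
  by move: u1; rewrite /= nrmE lecR.
have lb u : nrm u <= 1 -> ((nrm (T u))%:E <= opnorm T)%E.
  move=> u1; apply: ereal_sup_ubound; exists u => //=.
  by rewrite nrmE lecR.
have : (0 <= opnorm T)%E.
  by apply: le_trans (lb 0 _); rewrite ?lee_fin ?nrm_ge0 // nrm0.
case e : (opnorm T) (ub _ c0_ge0 Tc0) => [z| |] // _ z0.
exists z; split => //.
  move=> u; have [u0|n0] := eqVneq (nrm u) 0.
    by rewrite (nrm_eq0 u0) (op0 bT) nrm0 mulr0.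
  have up : 0 < nrm u by rewrite lt_neqAle eq_sym n0 nrm_ge0.
  have := lb (rsc (nrm u)^-1 u).
  rewrite (opR bT) !nrmZ ger0_norm ?invr_ge0 ?nrm_ge0 // mulVf // => /(_ (lexx _)).
  by rewrite e lee_fin ler_pdivrMl // mulrC.
by move=> c c_ge0 /(ub _ c_ge0); rewrite e lee_fin.
Qed.

Lemma bnd_adj T U z : (forall u v, rip (T u) v = rip u (U v)) -> bnd T z -> bnd U z.
Proof.
move=> h hz v.
have h1 : nrm (U v) * nrm (U v) <= z * nrm v * nrm (U v).
  rewrite -expr2 -rip_nrm -h; apply: le_trans (nrm_rip _ _) _.
  by rewrite mulrAC ler_wpM2r ?nrm_ge0.
have [n0|n0] := eqVneq (nrm (U v)) 0; last first.
  by move: h1; rewrite ler_pM2r // lt_neqAle eq_sym n0 nrm_ge0.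
rewrite n0; have [v0|v0] := eqVneq (nrm v) 0; first by rewrite v0 mulr0.
have := hz v; have := nrm_ge0 (T v); have := nrm_ge0 v.
move=> v_ge0 a b; exact: le_trans a b.
Qed.

(** If X is at distance at least r + d from c on the range of L while Y is within
    r of c on the range of P, then Z = L N P satisfies
      (X - c) Z = L (X N - N Y) P + Z (Y - c) P,
    so the norm z of Z obeys (r + d) z <= e + z r. *)
Lemma sylvester X Y L N P c r d e : bounded_op X -> bounded_op Y -> bounded_op N ->
  oproj L -> oproj P -> comm L X -> comm P Y -> 0 <= r -> 0 < d -> 0 <= e ->
  bnd (fun v => X (N v) - N (Y v)) e ->
  (forall v, L v = v -> (r + d) * nrm v <= nrm (X v - rsc c v)) ->
  (forall v, P v = v -> nrm (Y v - rsc c v) <= r * nrm v) ->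
  bnd (fun v => L (N (P v))) (e / d).
Proof.
move=> bX bY bN hL hP cL cP r0 d0 e0 hXN low up.
have [bL sL LL] := hL; have [bP sP PP] := hP.
have bZ : bounded_op (fun v => L (N (P v))) := bop_comp bL (bop_comp bN bP).
(* the least bound z of Z is compared with the bound that z itself implies *)
have [z [_ z0 Zz zmin]] := opnormP bZ.
have rd : 0 < r + d by lra.
have : z <= (e + z * r) / (r + d).
  apply: zmin; first by rewrite divr_ge0 ?(ltW rd) // addr_ge0 ?mulr_ge0.
  move=> v; rewrite mulrAC ler_pdivlMr // mulrC.
  apply: le_trans (low _ (LL _)) _.
  have Pv : P (Y (P v) - rsc c (P v)) = Y (P v) - rsc c (P v).
    by rewrite (opB bP) (opR bP) cP PP.
  have -> : X (L (N (P v))) - rsc c (L (N (P v))) =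
    L (X (N (P v)) - N (Y (P v))) + L (N (P (Y (P v) - rsc c (P v)))).
    by rewrite Pv (opB bN) (opR bN) !(opB bL) (opR bL) cL; vec.
  apply: le_trans (nrmD _ _) _.
  have h1 := le_trans (oproj_nrm _ hL) (hXN (P v)).
  have h2 := Zz (Y (P v) - rsc c (P v)); have h3 := up _ (PP v).
  have h4 := oproj_nrm v hP.
  have : e * nrm (P v) <= e * nrm v by rewrite ler_wpM2l.
  have : z * nrm (Y (P v) - rsc c (P v)) <= z * (r * nrm v).
    by rewrite ler_wpM2l //; apply: le_trans h3 _; rewrite ler_wpM2l.
  by move: h1 h2 => /=; lra.
rewrite ler_pdivlMr // => h.
have ze : z <= e / d by rewrite ler_pdivlMr //; lra.
by move=> v; apply: le_trans (Zz v) _; rewrite ler_wpM2r ?nrm_ge0.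
Qed.

(** [G, T] = [G - 1/2, T], and G - 1/2 is half an isometry. *)
Lemma commutator_projection G T c : oproj G -> bounded_op T -> bnd T c ->
  bnd (fun v => G (T v) - T (G v)) c.
Proof.
move=> hG bT Tc v; have [bG sG GG] := hG.
(* (G - 1/2)^2 = 1/4 *)
have half u : nrm (G u - rsc 2^-1 u) = 2^-1 * nrm u.
  have : nrm (G u - rsc 2^-1 u) ^+ 2 = (2^-1 * nrm u) ^+ 2.
    rewrite exprMn -!rip_nrm !(ripBl, ripBr, ripZl, ripZr) (rip_sym u (G u)).
    by rewrite (oproj_rip u hG); field.
  by move/eqP; rewrite eqrXn2 ?mulr_ge0 ?invr_ge0 ?nrm_ge0 // => /eqP.
have -> : G (T v) - T (G v) = (G (T v) - rsc 2^-1 (T v)) - T (G v - rsc 2^-1 v).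
  by rewrite (opB bT) (opR bT); vec.
apply: le_trans (nrmB _ _) _; rewrite half.
have := Tc v; have := Tc (G v - rsc 2^-1 v); rewrite half; lra.
Qed.

End Estimates.

(** * A block diagonal projection near a spectral window *)

Section NearProjection.
Context {R : realType} {H : hilbertType R}.
Variables (A : set (H -> H)) (S : set ((H -> H) -> (H -> H))).
Hypothesis vA : von_neumann_algebra A.
Hypothesis HS : forall phi, S phi -> linear_symmetry A phi /\ weakly_continuous A phi.
Implicit Types (u v w l : H) (r c s : R) (T U P Q G X Y : H -> H).
Local Notation fixed_op := (fixed_op A S).
Local Notation bicomm := (bicomm A S).

(** G is the spectral projection of X on the interval from a to b.  A vector in
    its kernel splits orthogonally into a part above b and a part below a. *)
Lemma spectral_window X (a b : R) : fixed_op X -> sym X -> a <= b ->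
  exists G, [/\ bicomm X G, oproj G,
    (forall v, G v = v -> a * rip v v <= rip (X v) v <= b * rip v v) &
    forall v, G v = 0 -> exists v1 v2, [/\ v = v1 + v2, rip v1 v2 = 0,
      b * rip v1 v1 <= rip (X v1) v1 & rip (X v2) v2 <= a * rip v2 v2]].
Proof.
move=> sX symX ab; have bX := fixed_op_bop vA sX.
pose Y c v := X v - rsc c v.
have kY c : bicomm X (Y c).
  by apply: (bicomm_sub vA HS); [exact: bicomm_self | apply: (bicomm_rsc vA HS); exact: bicomm_id].
have symY c : sym (Y c).
  by move=> u v; rewrite /Y ripBl ripBr ripZl ripZr symX.
have [P1 [[k1 s1 i1] [p1 n1 _]]] := positive_cut_exists vA HS (bicomm_fixed (kY a)) (symY a).
have [P2 [[k2 s2 i2] [p2 n2 _]]] := positive_cut_exists vA HS (bicomm_fixed (kY b)) (symY b).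
have {}k1 := bicomm_trans (kY a) k1; have {}k2 := bicomm_trans (kY b) k2.
have c12 := bicomm_comm vA sX k1 k2.
have b1 := bicomm_bop vA k1; have b2 := bicomm_bop vA k2.
have {}p1 v : P1 v = v -> a * rip v v <= rip (X v) v.
  by move=> /p1; rewrite ripBl ripZl subr_ge0.
have {}p2 v : P2 v = v -> b * rip v v <= rip (X v) v.
  by move=> /p2; rewrite ripBl ripZl subr_ge0.
have {}n1 v : P1 v = 0 -> rip (X v) v <= a * rip v v.
  by move=> /n1; rewrite ripBl ripZl subr_le0.
have {}n2 v : P2 v = 0 -> rip (X v) v <= b * rip v v.
  by move=> /n2; rewrite ripBl ripZl subr_le0.
pose G v := P1 v - P1 (P2 v).
have kG : bicomm X G by apply: (bicomm_sub vA HS k1); exact: bicomm_comp.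
have GP1 v : P1 (G v) = G v by rewrite /G (opB b1) !i1.
have GP2 v : P2 (G v) = 0 by rewrite /G (opB b2) -!c12 i2 subrr.
exists G; split=> //.
- split; first exact: (bicomm_bop vA kG).
  + by move=> u v; rewrite /G ripBl ripBr !s1 !s2 c12.
  + by move=> v; rewrite {1}/G GP1 GP2 (op0 b1) subr0.
- move=> v Gv; apply/andP; split; first by apply: p1; rewrite -Gv GP1.
  by apply: n2; rewrite -Gv GP2.
move=> v /eqP; rewrite subr_eq0 => /eqP Gv.
exists (P1 v), (v - P1 v); split.
- by rewrite addrC subrK.
- by rewrite s1 (opB b1) i1 subrr rip0r.
- by apply: p2; rewrite Gv -c12 i2.
- by apply: n1; rewrite (opB b1) i1 subrr.
Qed.

(** Let T = P G P and let F be the cut of T - 1/2.  On the kernel of F one has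
    0 <= T <= 1/2, so T^2 <= T - T^2; on its range 0 <= 1 - T <= 1/2, so
    (1 - T)^2 <= T - T^2.  Hence (T - F)^2 <= T - T^2, and
    <(T - T^2) v, v> is the squared norm of (1 - P) G P v. *)
Lemma compression_cut P G e : fixed_op P -> oproj P -> fixed_op G -> oproj G -> 0 <= e ->
  bnd (fun v => G (P v) - P (G (P v))) e ->
  exists F, [/\ fixed_op F, oproj F, (forall v, P (F v) = F v), (forall v, F (P v) = F v) &
    forall v, nrm (P (G (P v)) - F v) <= e * nrm (P v)].
Proof.
move=> SP hP SG hG e0 hb; have [bP sP PP] := hP; have [bG sG GG] := hG.
pose T v := P (G (P v)).
have ST : fixed_op T by exact: (fixed_op_compress vA HS SP SG).
have bT := fixed_op_bop vA ST.
have symT : sym T by move=> u v; rewrite /T sP sG sP.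
have Tq v : rip (T v) v = rip (G (P v)) (G (P v)) by rewrite /T sP (oproj_rip (P v) hG).
have T0 v : 0 <= rip (T v) v by rewrite Tq rip_ge0.
have T1 v : rip (T v) v <= rip v v.
  rewrite Tq !rip_nrm ler_sqr ?nnegrE ?nrm_ge0 //.
  exact: le_trans (oproj_nrm _ hG) (oproj_nrm _ hP).
pose Y v := T v - rsc 2^-1 v.
have kY : bicomm T Y.
  by apply: (bicomm_sub vA HS); [exact: bicomm_self | apply: (bicomm_rsc vA HS); exact: bicomm_id].
have symY : sym Y by move=> u v; rewrite /Y ripBl ripBr ripZl ripZr symT.
have [F [[kF sF FF] [p1 n1 _]]] := positive_cut_exists vA HS (bicomm_fixed kY) symY.
have bF := bicomm_bop vA kF.
have cFT : comm F T by apply: (bicomm_comm vA ST (bicomm_trans kY kF)); exact: bicomm_self.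
have cPF : comm P F.
  apply: (bicomm_trans kY kF).2 => // v; by rewrite /T !PP.
have p1' v : F v = v -> 2^-1 * rip v v <= rip (T v) v.
  by move=> /p1; rewrite ripBl ripZl subr_ge0.
have n1' v : F v = 0 -> rip (T v) v <= 2^-1 * rip v v.
  by move=> /n1; rewrite ripBl ripZl subr_le0.
have PF v : P (F v) = F v.
  have : F v - P (F v) = 0; last by move/eqP; rewrite subr_eq0 => /eqP.
  set z := F v - P (F v).
  have Fz : F z = z by rewrite /z (opB bF) -cPF !FF.
  have Pz : P z = 0 by rewrite /z (opB bP) PP subrr.
  have := p1' z Fz; rewrite Tq Pz (op0 bG) rip0l => h.
  apply: rip_eq0; apply: le_anti; rewrite rip_ge0 andbT.
  by have := rip_ge0 z; lra.
exists F; split => //.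
- by case: kF.
- by move=> v; rewrite -cPF PF.
move=> v; apply: nrm_le; first by rewrite mulr_ge0 ?nrm_ge0.
rewrite -/(T v).
have [y yE] : exists y, y = F v by exists (F v).
have [w wE] : exists w, w = v - y by exists (v - y).
have Fy : F y = y by rewrite yE FF.
have Fw : F w = 0 by rewrite wE (opB bF) Fy yE subrr.
pose U u := u - T u.
have bU : bounded_op U by exact: bop_sub bop_id bT.
have symU : sym U by move=> u u'; rewrite /U ripBl ripBr symT.
(* T^2 <= T / 2 on the kernel of F, U^2 <= U / 2 on its range *)
have hTw : rip (T w) (T w) <= 2^-1 * rip (T w) w.
  apply: positive_square_le => //.
  by apply: n1'; rewrite cFT Fw (op0 bT).
have hUy : rip (U y) (U y) <= 2^-1 * rip (U y) y.
  apply: positive_square_le => //.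
    by move=> s; rewrite {1}/U ripBl subr_ge0.
  have FU : F (U y) = U y by rewrite /U (opB bF) cFT Fy.
  by rewrite {1}/U ripBl; have := p1' _ FU; lra.
have orth u u' : F u = 0 -> F u' = u' -> rip u u' = 0.
  by move=> hu <-; rewrite -sF hu rip0l.
have FTw : F (T w) = 0 by rewrite cFT Fw (op0 bT).
have FTy : F (T y) = T y by rewrite cFT Fy.
have ev : v = w + y by rewrite wE subrK.
have e1 : T v - F v = T w - U y by rewrite -yE {1}ev (opD bT) /U; vec.
have o1 : rip (T w) (U y) = 0 by apply: orth; rewrite // /U (opB bF) Fy FTy.
have o2 : rip (T w) y = 0 by exact: orth.
have o3 : rip (T w) (T y) = 0 by exact: orth.
have e2 : rip (T v) v = rip (T w) w + rip (T y) y.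
  by rewrite {1 2}ev (opD bT) ripDl !ripDr o2 (symT y w) (rip_sym y) o2; ring.
have e3 : rip (T v) (T v) = rip (T w) (T w) + rip (T y) (T y).
  by rewrite {1 2}ev (opD bT) ripDl !ripDr (rip_sym (T y) (T w)) o3; ring.
have e4 : rip (T v) v - rip (T v) (T v) =
    rip (G (P v) - P (G (P v))) (G (P v) - P (G (P v))).
  by rewrite Tq (oproj_split (G (P v)) hP) addrC addKr.
have h4 : rip (T v) v - rip (T v) (T v) <= (e * nrm (P v)) ^+ 2.
  rewrite e4 rip_nrm ler_sqr ?nnegrE ?nrm_ge0 ?mulr_ge0 ?nrm_ge0 //.
  by have := hb (P v); rewrite PP.
apply: le_trans h4; rewrite e1 e2 e3.
move: hTw hUy; rewrite /U !(ripBl, ripBr) !(rip_sym _ (T y)).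
have := o1; rewrite /U ripBr => o1'.
rewrite (rip_sym (T y) (T w)) (rip_sym y (T w)) o2 o3.
lra.
Qed.

(** For projections, the two equations mean F <= P. *)
Definition subproj F P := [/\ fixed_op F, oproj F, (forall v, P (F v) = F v) &
  (forall v, F (P v) = F v)].

(** Decompose G v along the four projections.  The columns P0 and Q contribute a
    each; the off-diagonal part of each of the columns Pm and Pp contributes
    2 a + b; the diagonal differences Pm G Pm - Fm and Pp G Pp - Fp act on
    orthogonal spaces, so together they contribute 2 a + b only once. *)
Lemma projection_near_window P0 Pm Pp Q G (a b : R) : 0 <= a -> 0 <= b ->
  oproj P0 -> fixed_op Pm -> oproj Pm -> fixed_op Pp -> oproj Pp -> oproj Q ->
  fixed_op G -> oproj G ->
  (forall v, P0 v + Pm v + Pp v + Q v = v) ->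
  (forall v, P0 (Pm v) = 0) -> (forall v, P0 (Pp v) = 0) ->
  (forall v, Pm (Pp v) = 0) -> (forall v, Pp (Pm v) = 0) ->
  bnd (fun v => P0 v - G (P0 v)) a -> bnd (fun v => G (Q v)) a ->
  bnd (fun v => Pp (G (Pm v))) b ->
  exists Fm Fp, [/\ subproj Fm Pm, subproj Fp Pp &
    bnd (fun v => Fm v + P0 v + Fp v - G v) (8 * a + 3 * b)].
Proof.
move=> a0 b0 h0 Sm hm Sp hp hQ SG hG sum z0m z0p zmp zpm B0 BQ Bpm.
have [b0' s0 i0] := h0; have [bm sm im] := hm; have [bp sp ip] := hp.
have [bQ sQ iQ] := hQ; have [bG sG iG] := hG.
have B0' : bnd (fun v => P0 v - P0 (G v)) a.
  by apply: bnd_adj B0 => u v; rewrite ripBl ripBr sG !s0.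
have BQ' : bnd (fun v => Q (G v)) a by apply: bnd_adj BQ => u v; rewrite sG sQ.
have Bmp : bnd (fun v => Pm (G (Pp v))) b.
  by apply: bnd_adj Bpm => u v; rewrite sp sG sm.
have block P P' : oproj P -> (forall v, P0 (P v) = 0) ->
    (forall v, P0 v + P v + P' v + Q v = v) -> bnd (fun v => P' (G (P v))) b ->
    bnd (fun v => G (P v) - P (G (P v))) (2 * a + b).
  move=> hP zP sP BP v.
  have -> : G (P v) - P (G (P v)) =
      P' (G (P v)) + (Q (G (P v)) - (P0 (P v) - P0 (G (P v)))).
    by rewrite zP -{1}[G (P v)]sP; vec.
  apply: le_trans (nrmD _ _) _.
  have := nrmB (Q (G (P v))) (P0 (P v) - P0 (G (P v))).
  have hPv := ler_wpM2l a0 (oproj_nrm v hP).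
  by have := BP v; have := BQ' (P v); have := B0' (P v); lra.
have blm := block _ _ hm z0m sum Bpm.
have blp : bnd (fun v => G (Pp v) - Pp (G (Pp v))) (2 * a + b).
  apply: (block _ Pm hp z0p _ Bmp) => v.
  by rewrite -[RHS]sum; vec.
have e0 : 0 <= 2 * a + b by lra.
have [Fm [SFm hFm PFm FPm dm]] := compression_cut Sm hm SG hG e0 blm.
have [Fp [SFp hFp PFp FPp dp]] := compression_cut Sp hp SG hG e0 blp.
exists Fm, Fp; split => //.
move=> v.
pose x := Pm (G (Pm v)) - Fm v; pose y := Pp (G (Pp v)) - Fp v.
have xy : nrm (x + y) <= (2 * a + b) * nrm v.
  have Px : Pm x = x by rewrite /x (opB bm) im PFm.
  have Py : Pp y = y by rewrite /y (opB bp) ip PFp.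
  have oxy : rip x y = 0 by rewrite -Px -Py sm zmp rip0r.
  apply: nrm_le; first by rewrite mulr_ge0 ?nrm_ge0.
  have -> : rip (x + y) (x + y) = rip x x + rip y y.
    by move: x y oxy {Px Py} => x y oxy; rewrite ripDl !ripDr (rip_sym y x) oxy; ring.
  have h1 : rip x x <= (2 * a + b) ^+ 2 * rip (Pm v) (Pm v).
    by rewrite !rip_nrm -exprMn ler_sqr ?nnegrE ?mulr_ge0 ?nrm_ge0 //; exact: dm.
  have h2 : rip y y <= (2 * a + b) ^+ 2 * rip (Pp v) (Pp v).
    by rewrite !rip_nrm -exprMn ler_sqr ?nnegrE ?mulr_ge0 ?nrm_ge0 //; exact: dp.
  have h3 : rip (Pm v) (Pm v) + rip (Pp v) (Pp v) <= rip v v.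
    rewrite [leRHS](oproj_split v hm) lerD2l.
    rewrite (_ : Pp v = Pp (v - Pm v)); last by rewrite (opB bp) zpm subr0.
    by rewrite [leRHS](oproj_split _ hp) lerDl rip_ge0.
  apply: le_trans (lerD h1 h2) _; rewrite -mulrDr exprMn -rip_nrm.
  by rewrite ler_wpM2l ?sqr_ge0.
have Gv : G v = G (P0 v) + G (Pm v) + G (Pp v) + G (Q v) by rewrite -!(opD bG) sum.
have -> : Fm v + P0 v + Fp v - G v = (P0 v - G (P0 v)) - G (Q v)
    - (G (Pm v) - Pm (G (Pm v))) - (G (Pp v) - Pp (G (Pp v))) - (x + y).
  by rewrite Gv /x /y; vec.
have t1 := nrmB (P0 v - G (P0 v)) (G (Q v)).
have t2 := nrmB (P0 v - G (P0 v) - G (Q v)) (G (Pm v) - Pm (G (Pm v))).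
have t3 := nrmB (P0 v - G (P0 v) - G (Q v) - (G (Pm v) - Pm (G (Pm v))))
  (G (Pp v) - Pp (G (Pp v))).
apply: le_trans (nrmB _ _) _.
have := B0 v; have := BQ v; have := blm v; have := blp v => /=.
move: t1 t2 t3 xy; lra.
Qed.

(** [F, B] = [F - G, B] - [G, B' - B], because G commutes with B'. *)
Lemma commutator_near_projection F G B B' k b t : oproj G -> bounded_op B -> bounded_op B' ->
  comm G B' -> 0 <= k -> 0 <= b ->
  bnd (fun v => F v - G v) k -> bnd B b -> bnd (fun v => B' v - B v) t ->
  bnd (commutator F B) (2 * k * b + t).
Proof.
move=> hG bB bB' cGB k0 b0 hF hB ht v; have [bG _ _] := hG.
have ht' := commutator_projection hG (bop_sub bB' bB) ht.
have -> : commutator F B v = F (B v) - B (F v) by [].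
have -> : F (B v) - B (F v) = (F (B v) - G (B v)) - B (F v - G v)
   - (G (B' v - B v) - (B' (G v) - B (G v))).
  by rewrite (opB bB) (opB bG) cGB; vec.
apply: le_trans (nrmB _ _) _.
have := nrmB (F (B v) - G (B v)) (B (F v - G v)).
have h1 := hF (B v); have h2 := hB (F v - G v); have h3 := ht' v.
have h4 := ler_wpM2l k0 (hB v); have h5 := ler_wpM2l b0 (hF v).
move: h1 h2 h3 h4 h5 => /=; lra.
Qed.

Section Windows.
Variables (X X' : H -> H) (E : set R -> H -> H).
Hypotheses (sX : fixed_op X) (symX : sym X) (sX' : fixed_op X') (symX' : sym X').
Hypothesis (hE : is_spectral_measure X E).
Let bX := fixed_op_bop vA sX.
Let bX' := fixed_op_bop vA sX'.

Lemma specm_oproj D : measurable D -> oproj (E D).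
Proof.
move=> mD; split; [exact: (specm_bop hE) | exact: (specm_sym hE) |].
by move=> v; exact: (specm_idem hE).
Qed.

(** G is the spectral projection of X' on the interval that sticks out of
    [a, b] by d / 2 on both sides, halfway towards D. *)
Lemma window_estimates (e a b d : R) (D0 D : set R) :
  0 <= e -> bnd (fun v => X' v - X v) e -> a <= b -> 0 < d ->
  measurable D0 -> measurable D ->
  (forall x, D0 x -> a <= x <= b) ->
  (forall x, D x -> x <= a - d \/ b + d <= x) ->
  exists G, [/\ bicomm X' G, oproj G, bnd (fun v => E D0 v - G (E D0 v)) (2 * e / d) &
    bnd (fun v => G (E D v)) (2 * e / d)].
Proof.
move=> e0 he ab d0 mD0 mD hD0 hD.
have ab' : a - d / 2 <= b + d / 2 by lra.
have [G [kG hG Gin Gout]] := spectral_window sX' symX' ab'.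
exists G; split => //.
  have -> : 2 * e / d = e / (d / 2) by field; rewrite gt_eqF.
  apply: (@sylvester _ _ X' X (fun v => v - G v) (fun v => v) (E D0) ((a + b) / 2)
    ((b - a) / 2) (d / 2) e) => //.
  - exact: bop_id.
  - exact: oproj_C.
  - exact: specm_oproj.
  - by move=> v; rewrite (opB bX') (bicomm_commY vA sX' kG).
  - exact: (specm_comm bX symX hE).
  - lra.
  - lra.
  - move=> v Lv; have Gv : G v = 0.
      by move: Lv => /(congr1 (fun z => v - z)); rewrite subKr subrr.
    have [v1 [v2 [-> o h1 h2]]] := Gout v Gv.
    apply: norm_lower_bound => //.
    + by have -> : (a + b) / 2 + ((b - a) / 2 + d / 2) = b + d / 2 by field.
    + by have -> : (a + b) / 2 - ((b - a) / 2 + d / 2) = a - d / 2 by field.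
  - move=> v; apply: norm_of_numerical_range => //.
    + exact: specm_oproj.
    + exact: (specm_comm bX symX hE).
    + lra.
    + move=> u Eu; apply/andP; split.
        have -> : (a + b) / 2 - (b - a) / 2 = a by field.
        by apply: (specm_ge hE mD0) => // x /hD0/andP[].
      have -> : (a + b) / 2 + (b - a) / 2 = b by field.
      by apply: (specm_le hE mD0) => // x /hD0/andP[].
have -> : 2 * e / d = e / (d / 2) by field; rewrite gt_eqF.
have [bG sG GG] := hG.
apply: (@bnd_adj _ _ (fun v => E D (G v))).
  by move=> u v; rewrite (specm_sym hE) // sG.
apply: (@sylvester _ _ X X' (E D) (fun v => v) G ((a + b) / 2)
    ((b - a) / 2 + d / 2) (d / 2) e) => //.
- exact: bop_id.
- exact: specm_oproj.
- exact: (specm_comm bX symX hE).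
- exact: (bicomm_commY vA sX' kG).
- lra.
- lra.
- by move=> v; rewrite -nrmN opprB; exact: he.
- move=> v Ev.
  have mL : measurable [set x | x < b + d].
    by rewrite -set_itvNyo; exact: measurable_itv.
  have mR := measurableC mL.
  (* the parts of v above b + d and below a - d *)
  set v1 := E (~` [set x | x < b + d]) v; pose v2 := E [set x | x < b + d] v.
  have ev : v = v1 + v2 by rewrite /v1 (specm_C hE) // /v2 subrK.
  have Ev2 : E (D `&` [set x | x < b + d]) v2 = v2.
    rewrite (specm_I hE) // (specm_idem hE) // /v2.
    by rewrite -(specm_I hE) // setIC (specm_I hE) // Ev.
  have o : rip v1 v2 = 0.
    rewrite /v1 /v2 (specm_sym hE) // -(specm_I hE) // setICl (specm_0 hE) rip0r //.
  rewrite {1 2 3}ev; apply: norm_lower_bound => //.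
  + have -> : (a + b) / 2 + ((b - a) / 2 + d / 2 + d / 2) = b + d by field.
    apply: (specm_ge hE mR); last by rewrite /v1 (specm_idem hE).
    by move=> x /= /negP; rewrite -leNgt.
  + have -> : (a + b) / 2 - ((b - a) / 2 + d / 2 + d / 2) = a - d by field.
    apply: (specm_le hE (measurableI _ _ mD mL) _ Ev2) => x /= [/hD [] //].
    by move=> h /(le_lt_trans h); rewrite ltxx.
move=> v; apply: norm_of_numerical_range => //.
- exact: (bicomm_commY vA sX' kG).
- lra.
- move=> u /Gin.
  have -> : (a + b) / 2 - ((b - a) / 2 + d / 2) = a - d / 2 by field.
  by have -> : (a + b) / 2 + ((b - a) / 2 + d / 2) = b + d / 2 by field.
Qed.

(** X is bounded, so the half-line below m can be cut to an interval [q, m] centred at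
    (q + m) / 2.  The commutator of X with G is that of X - X' with G. *)
Lemma gap_bound (e m d : R) (Dm Dp : set R) G :
  0 <= e -> bnd (fun v => X' v - X v) e -> 0 < d -> bicomm X' G -> oproj G ->
  measurable Dm -> measurable Dp ->
  (forall x, Dm x -> x <= m) -> (forall x, Dp x -> m + d <= x) ->
  bnd (fun v => E Dp (G (E Dm v))) (e / d).
Proof.
move=> e0 he d0 kG hG mm mp hm hp.
have cG := bicomm_commY vA sX' kG; have bG := oproj_bop hG.
have [_ [M M0 hM]] := (bounded_opP X).1 bX.
(* q is below the spectrum of X, and q <= m makes the radius nonnegative *)
pose q := Num.min (- M) m.
have qM : q <= - M by rewrite /q ge_min lexx.
have qm : q <= m by rewrite /q ge_min lexx orbT.
have Xq u : q * rip u u <= rip (X u) u.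
  have : - rip (X u) u <= M * rip u u.
    rewrite -ripNr; apply: le_trans (nrm_rip _ _) _; rewrite nrmN rip_nrm expr2 mulrA.
    by rewrite ler_wpM2r ?nrm_ge0.
  have := ler_wpM2r (rip_ge0 u) qM; lra.
apply: (@sylvester _ _ X X (E Dp) G (E Dm) ((q + m) / 2) ((m - q) / 2) d e) => //.
- exact: specm_oproj.
- exact: specm_oproj.
- exact: (specm_comm bX symX hE).
- exact: (specm_comm bX symX hE).
- lra.
- move=> v.
  have := commutator_projection hG (bop_sub bX' bX) he v.
  congr (nrm _ <= _); rewrite (opB bG) cG; vec.
- move=> v Ev; rewrite -[v]addr0; apply: norm_lower_bound => //.
  + by rewrite rip0r.
  + have -> : (q + m) / 2 + ((m - q) / 2 + d) = m + d by field.
    exact: (specm_ge hE mp).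
  + by rewrite (op0 bX) !rip0r mulr0.
- move=> v; apply: norm_of_numerical_range => //.
  + exact: specm_oproj.
  + exact: (specm_comm bX symX hE).
  + lra.
  + move=> u Eu; have -> : (q + m) / 2 - (m - q) / 2 = q by field.
    have -> : (q + m) / 2 + (m - q) / 2 = m by field.
    by rewrite Xq /=; exact: (specm_le hE mm).
Qed.

End Windows.
End NearProjection.

(** * The projection between two intervals *)

Section Final.
Context {R : realType} {H : hilbertType R}.
Variables (A : set (H -> H)) (S : set ((H -> H) -> (H -> H))).
Hypothesis vA : von_neumann_algebra A.
Hypothesis HS : forall phi, S phi -> linear_symmetry A phi /\ weakly_continuous A phi.
Implicit Types (u v w l : H) (r c s : R) (T U P Q G Y : H -> H).
Local Notation fixed_op := (fixed_op A S).
Local Notation bicomm := (bicomm A S).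
Local Notation subproj := (subproj A S).
Variables (X X' : H -> H) (E : set R -> H -> H).
Hypotheses (sX : fixed_op X) (symX : sym X) (sX' : fixed_op X') (symX' : sym X').
Hypothesis (hE : is_spectral_measure X E).
Variables (O0 O Om Op : set R).
Hypotheses (iO0 : is_interval O0) (iO : is_interval O) (cO : compactly_contained O0 O)
  (im : is_interval Om) (ip : is_interval Op) (OU : Om `|` Op = O `\` O0)
  (Olt : forall x y, Om x -> Op y -> x < y).

Let g0 := bicomm_set_interval vA HS sX symX hE iO0.
Let gm := bicomm_set_interval vA HS sX symX hE im.
Let gp := bicomm_set_interval vA HS sX symX hE ip.
Let m0 := g0.1.
Let mm := gm.1.
Let mp := gp.1.
Let mO := (bicomm_set_interval vA HS sX symX hE iO).1.
Let S0 : fixed_op (E O0) := bicomm_fixed g0.2.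
Let Sm : fixed_op (E Om) := bicomm_fixed gm.2.
Let Sp : fixed_op (E Op) := bicomm_fixed gp.2.

Lemma core_sub_outer : O0 `<=` O.
Proof. by case: cO => _ h x /subset_closure /h /interior_subset. Qed.
Lemma sides_disjoint : Om `&` Op = set0.
Proof. by apply/seteqP; split => // x [h1 h2]; have := Olt h1 h2; rewrite ltxx. Qed.
Lemma core_left_disjoint : O0 `&` Om = set0.
Proof.
apply/seteqP; split => // x [h1 h2].
have : (O `\` O0) x by rewrite -OU; left.
by case.
Qed.
Lemma core_right_disjoint : O0 `&` Op = set0.
Proof.
apply/seteqP; split => // x [h1 h2].
have : (O `\` O0) x by rewrite -OU; right.
by case.
Qed.

Lemma specm_O v : E O v = E Om v + E O0 v + E Op v.
Proof.
have -> : O = (Om `|` O0) `|` Op.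
  by rewrite setUAC OU setUC setDUK //; exact: core_sub_outer.
rewrite (specm_U hE) //; last 2 first.
- exact: measurableU.
- by rewrite setIUl sides_disjoint core_right_disjoint setU0.
by rewrite (specm_U hE) // setIC core_left_disjoint.
Qed.

Lemma specm_disj D1 D2 v : measurable D1 -> measurable D2 -> D1 `&` D2 = set0 ->
  E D1 (E D2 v) = 0.
Proof. by move=> h1 h2 h; rewrite -(specm_I hE) // h (specm_0 hE). Qed.

Definition band Fm Fp : H -> H := Fm + E O0 + Fp.

Lemma oproj_projection P : oproj P -> projection P.
Proof.
move=> [bP sP PP]; split => //; first exact/funext.
exact/sym_self_adjoint.
Qed.

Lemma band_properties Fm Fp : subproj Fm (E Om) -> subproj Fp (E Op) ->
  let F := band Fm Fp in
  [/\ A F /\ projection F /\ S_symmetric S F,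
      op_le (E O0) F /\ op_le F (E O)
    & [/\ F = Fm + E O0 + Fp,
          A Fm /\ projection Fm /\ S_symmetric S Fm,
          A Fp /\ projection Fp /\ S_symmetric S Fp,
          op_le Fm (E Om)
        & op_le Fp (E Op)]].
Proof.
move=> [SFm hm mF Fm'] [SFp hp pF Fp'] F.
have [bm sm im'] := hm; have [bp sp ip'] := hp.
have b0 := specm_bop hE m0; have s0 := specm_sym hE m0.
have SF : fixed_op F.
  have := fixed_op_add vA HS (fixed_op_add vA HS SFm S0) SFp; exact.
have bF := fixed_op_bop vA SF.
have Fv v : F v = Fm v + E O0 v + Fp v by [].
have z1 v : Fm (E O0 v) = 0 by rewrite -Fm' specm_disj ?(op0 bm) // setIC core_left_disjoint.
have z2 v : Fm (Fp v) = 0 by rewrite -pF -Fm' specm_disj ?(op0 bm) // sides_disjoint.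
have z3 v : E O0 (Fm v) = 0 by rewrite -mF specm_disj // core_left_disjoint.
have z4 v : E O0 (Fp v) = 0 by rewrite -pF specm_disj // core_right_disjoint.
have z5 v : Fp (E O0 v) = 0 by rewrite -Fp' specm_disj ?(op0 bp) // setIC core_right_disjoint.
have z6 v : Fp (Fm v) = 0 by rewrite -mF -Fp' specm_disj ?(op0 bp) // setIC sides_disjoint.
have hF : oproj F.
  split=> //.
    by move=> u v; rewrite !Fv !ripDl !ripDr sm sp s0.
  move=> v; rewrite !Fv !(opD bm) !(opD b0) !(opD bp).
  by rewrite im' ip' (specm_idem hE) // z1 z2 z3 z4 z5 z6; vec.
have hEm := specm_oproj hE mm; have hEp := specm_oproj hE mp.
have pos P u : oproj P -> 0 <= rip (P u) u by move=> hP; rewrite (oproj_rip u hP) rip_ge0.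
have le P Q u : oproj P -> oproj Q -> (forall v, P (Q v) = P v) -> rip (P u) u <= rip (Q u) u.
  move=> hP hQ PQ; rewrite (oproj_rip u hP) (oproj_rip u hQ) !rip_nrm ler_sqr ?nnegrE ?nrm_ge0 //.
  by rewrite -PQ; apply: oproj_nrm.
split; first by case: SF => ? ?; split; [|split] => //; exact: oproj_projection.
- split; apply: op_le_rip => //; try exact: (specm_sym hE).
  + by move=> u v; case: hF.
  + move=> u; rewrite Fv !ripDl; have := pos _ u hm; have := pos _ u hp; lra.
  + exact: (specm_bop hE).
  + by case: hF.
  + by move=> u; rewrite Fv specm_O !ripDl !lerD // le.
split => //.
- by case: SFm => ? ?; split; [|split] => //; exact: oproj_projection.
- by case: SFp => ? ?; split; [|split] => //; exact: oproj_projection.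
- by apply: op_le_rip => //; [exact: (specm_bop hE)|exact: (specm_sym hE)|move=> u; exact: le].
- by apply: op_le_rip => //; [exact: (specm_bop hE)|exact: (specm_sym hE)|move=> u; exact: le].
Qed.

Lemma subproj_0 P : bounded_op P -> subproj (fun=> 0) P.
Proof.
move=> bP; split => //; first exact: fixed_op_0.
  split => //; first by apply: fixed_op_bop (fixed_op_0 vA HS).
  by move=> u v; rewrite rip0l rip0r.
by move=> v; rewrite (op0 bP).
Qed.

Local Open Scope ereal_scope.

Lemma set_dist_ge0 (D1 D2 : set R) : 0 <= set_dist D1 D2.
Proof.
by apply: le_ereal_inf_tmp => _ [x [y [_ _ ->]]]; rewrite lee_fin.
Qed.

Lemma set_dist_le (D1 D2 : set R) x y : D1 x -> D2 y ->
  set_dist D1 D2 <= `|x - y|%:E.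
Proof. by move=> h1 h2; apply: ereal_inf_lbound; exists x, y. Qed.

Definition coef := 24%:E / set_dist (~` O) O0 +
  Order.max (16%:E / set_dist (~` O) O0) (32%:E / set_dist Om Op).

Lemma coef_ge0 : 0 <= coef.
Proof.
have h : 0 <= 24%:E / set_dist (~` O) O0.
  by rewrite mule_ge0 ?inve_ge0 ?set_dist_ge0 // lee_fin.
apply: adde_ge0 => //; rewrite le_max; apply/orP; left.
by rewrite mule_ge0 ?inve_ge0 ?set_dist_ge0 // lee_fin.
Qed.

Local Close Scope ereal_scope.

Lemma core_bounds : has_lbound O0 /\ has_ubound O0.
Proof.
have [cc _] := cO; have [M [_ hM]] := compact_bounded cc.
have h x : O0 x -> `|x| <= M + 1.
  by move=> /subset_closure; apply: hM; rewrite ltrDl.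
split; [exists (- (M + 1)) | exists (M + 1)] => x /h; rewrite ler_norml => /andP[] //.
Qed.

(** Omega is an interval containing Omega0, so a point outside it lies on one side
    of the whole of Omega0. *)
Lemma outside_dichotomy (d : R) x : (0 <= d)%R -> O0 !=set0 ->
  set_dist (~` O) O0 = d%:E -> ~ O x -> x <= inf O0 - d \/ sup O0 + d <= x.
Proof.
move=> d0 ne dist Ox; have [hl hu] := core_bounds.
have hd y : O0 y -> d <= `|x - y|.
  by move=> Oy; rewrite -lee_fin -dist; apply: set_dist_le.
have [[y [Oy xy]]|h] := pselect (exists y, O0 y /\ x <= y); last first.
  right; rewrite -lerBrDr; apply: ge_sup => // y Oy.
  have yx : y < x by rewrite ltNge; apply/negP => xy; apply: h; exists y.
  by have := hd y Oy; rewrite ger0_norm ?subr_ge0 ?(ltW yx) //; lra.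
left; rewrite lerBrDr; apply: lb_le_inf => // z Oz.
have xz : x <= z.
  rewrite leNgt; apply/negP => zx; apply: Ox.
  by apply: (iO (core_sub_outer Oz) (core_sub_outer Oy)); rewrite (ltW zx) xy.
by have := hd z Oz; rewrite ler0_norm ?subr_le0 //; lra.
Qed.

Section Choice.
Variable e : R.
Hypotheses (e0 : 0 <= e) (he : bnd (fun v => X' v - X v) e).

(** The number w is 32 / d2, which is 0 when one of the sides is empty; in that
    case the bound b can be taken to be 0. *)
Lemma gap_estimate G : bicomm X' G -> oproj G -> (set_dist Om Op != 0)%E ->
  exists b w : R, [/\ 0 <= b, 0 <= w, (32%:E / set_dist Om Op)%E = w%:E, 32 * b <= w * e &
   bnd (fun v => E Op (G (E Om v))) b].
Proof.
move=> kG hG dn0; have bG := oproj_bop hG.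
have [w [w0 hw hw']] : exists w : R, [/\ 0 <= w, (32%:E / set_dist Om Op)%E = w%:E &
    forall r, set_dist Om Op = r%:E -> w = 32 / r].
  move: dn0; have := set_dist_ge0 Om Op; case: (set_dist Om Op) => [r| |] //=.
    rewrite lee_fin eqe => r0 rn; exists (32 / r).
    by rewrite divr_ge0 //; split => // [|r' [->]] //; rewrite inver (negbTE rn).
  by move=> _ _; exists 0; split => //; rewrite invey mule0.
have [Om0|/set0P[x0 Omx0]] := eqVneq Om set0.
  exists 0, w; split => //; first by rewrite mulr0 mulr_ge0.
  move=> v; rewrite Om0 (specm_0 hE) (op0 bG) (op0 (specm_bop hE mp)) nrm0 mul0r //.
have [Op0|/set0P[y0 Opy0]] := eqVneq Op set0.
  exists 0, w; split => //; first by rewrite mulr0 mulr_ge0.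
  by move=> v; rewrite Op0 (specm_0 hE) nrm0 mul0r.
have [r hr] : exists r, set_dist Om Op = r%:E.
  have := set_dist_le Omx0 Opy0; have := set_dist_ge0 Om Op.
  by case: (set_dist Om Op) => [r| |] //; exists r.
have r0 : 0 < r.
  rewrite lt_neqAle -lee_fin -hr set_dist_ge0 andbT eq_sym.
  by move: dn0; rewrite hr eqe.
exists (e / r), w; split => //.
- by rewrite divr_ge0 // ltW.
- by rewrite (hw' _ hr) mulrAC mulrA mulrAC.
have ub : has_ubound Om by exists y0 => x Omx; apply/ltW/Olt.
apply: (gap_bound vA sX symX sX' hE e0 he r0 kG hG mm mp (m := sup Om)).
  by move=> x; exact: ub_le_sup.
move=> y Opy; rewrite -lerBrDr; apply: ge_sup; first by exists x0.
move=> x Omx; have := set_dist_le Omx Opy; rewrite hr lee_fin.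
by rewrite ltr0_norm ?subr_lt0 ?Olt //; lra.
Qed.

(** The real number c is at most the coefficient times e; stating the result
    with c keeps the extended real arithmetic out of the estimates. *)
Lemma band_exists : exists Fm Fp c, [/\ subproj Fm (E Om), subproj Fp (E Op), 0 <= c,
  (c%:E <= coef * e%:E)%E &
  forall B B' b t, bounded_op B -> bounded_op B' -> comm X' B' -> 0 <= b -> 0 <= t ->
    bnd B b -> bnd (fun v => B' v - B v) t -> bnd (commutator (band Fm Fp) B) (c * b + t)].
Proof.
have coe : (0 <= coef * e%:E)%E by rewrite mule_ge0 ?coef_ge0 ?lee_fin.
have bm := specm_bop hE mm; have bp := specm_bop hE mp.
(* F = 0 *)
have [emp|ne0] := eqVneq O0 set0.
  exists (fun=> 0), (fun=> 0), 0; split => //; [exact: subproj_0..|].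
  move=> B B' b t bB bB' _ b0 t0 hB ht v.
  have -> : commutator (band (fun=> 0) (fun=> 0)) B v = 0.
    rewrite -[LHS]/((0 + E O0 (B v) + 0) - B (0 + E O0 v + 0)).
    by rewrite emp !(specm_0 hE) !addr0 (op0 bB) subrr.
  by rewrite nrm0 mulr_ge0 ?nrm_ge0 // mul0r add0r.
(* F = 1 *)
have [full|neC] := eqVneq (~` O) set0.
  exists (E Om), (E Op), 0; split => //.
  - by split => //; [exact: (specm_oproj hE)|move=> v; exact: (specm_idem hE)..].
  - by split => //; [exact: (specm_oproj hE)|move=> v; exact: (specm_idem hE)..].
  move=> B B' b t bB bB' _ b0 t0 hB ht v.
  have -> : commutator (band (E Om) (E Op)) B v = 0.
    rewrite -[LHS]/((E Om (B v) + E O0 (B v) + E Op (B v)) - B (E Om v + E O0 v + E Op v)).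
    by rewrite -!specm_O -(setCK O) full setC0 !(specm_T hE) subrr.
  by rewrite nrm0 mulr_ge0 ?nrm_ge0 // mul0r add0r.
have [x Ox] : ~` O !=set0 by apply/set0P.
have ne : O0 !=set0 by apply/set0P.
have [y Oy] := ne.
have [d hd] : exists d, set_dist (~` O) O0 = d%:E.
  have := set_dist_le Ox Oy; have := set_dist_ge0 (~` O) O0.
  by case: (set_dist _ _) => [r| |] //; exists r.
have d0 : 0 <= d by rewrite -lee_fin -hd set_dist_ge0.
(* F = E Omega0: either X' = X and F commutes with B', or the coefficient is
   infinite and any bound, here c = 1, is below it *)
have [deg|nondeg] := pselect (d = 0 \/ set_dist Om Op = 0%E).
  have h0 v : band (fun=> 0) (fun=> 0) v = E O0 v.
    by rewrite -[LHS]/(0 + E O0 v + 0) add0r addr0.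
  have h0' : band (fun=> 0) (fun=> 0) = E O0 by exact/funext.
  have hP := specm_oproj hE m0.
  have [en|en] := eqVneq e 0.
    exists (fun=> 0), (fun=> 0), 0; split => //; [exact: subproj_0..|].
    move=> B B' b t bB bB' cXB b0 t0 hB ht.
    have XX : X' = X.
      apply/funext => v; have := he v; rewrite en mul0r => h.
      apply/eqP; rewrite -subr_eq0; apply/eqP/nrm_eq0/le_anti.
      by rewrite h nrm_ge0.
    have -> : 0 * b + t = 2 * 0 * b + t by ring.
    apply: (commutator_near_projection (G := E O0) hP bB bB') => //.
    + by apply: comm_sym; apply: (g0.2.2 _ bB'); rewrite -XX; apply: comm_sym.
    + by move=> v; rewrite h0 subrr nrm0 mul0r.
  exists (fun=> 0), (fun=> 0), 1; split => //; [exact: subproj_0..| |].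
    have -> : coef = +oo%E.
      have i2 := set_dist_ge0 (~` O) O0.
      case: deg => h; rewrite /coef.
        rewrite hd h inver eqxx gt0_muley ?lte_fin // addye //.
        by rewrite gt0_muley ?lte_fin // maxye.
      rewrite h inver eqxx (gt0_muley (_ : 0 < 32%:E)%E) ?lte_fin //.
      rewrite maxey addey // gt_eqF // (lt_le_trans ltNy0) //.
      by rewrite mule_ge0 ?inve_ge0 // lee_fin.
    by rewrite gt0_mulye ?leey // lte_fin lt_neqAle eq_sym en.
  move=> B B' b t bB bB' cXB b0 t0 hB ht v.
  have := commutator_projection hP bB hB v; rewrite h0' => h.
  by apply: le_trans h _; rewrite mul1r mulrDl lerDl mulr_ge0 ?nrm_ge0.
have dp : 0 < d.
  by rewrite lt_neqAle d0 andbT eq_sym; apply/eqP => h; apply: nondeg; left.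
have dn0 : (set_dist Om Op != 0)%E by apply/eqP => h; apply: nondeg; right.
have [hl hu] := core_bounds.
have ab : inf O0 <= sup O0.
  exact: le_trans (ge_inf hl Oy) (ub_le_sup hu Oy).
have [G [kG hG GB0 GBQ]] := window_estimates vA HS sX symX sX' symX' hE e0 he ab dp m0
  (measurableC mO) (fun x Ox => introT andP (conj (ge_inf hl Ox) (ub_le_sup hu Ox)))
  (fun x Ox => outside_dichotomy d0 ne hd Ox).
have [b [w [b0 w0 hw bw gapB]]] := gap_estimate kG hG dn0.
have a0 : 0 <= 2 * e / d by rewrite divr_ge0 // mulr_ge0.
have h0 := specm_oproj hE m0; have hm := specm_oproj hE mm; have hp := specm_oproj hE mp.
have hQ := specm_oproj hE (measurableC mO).
have z D1 D2 : measurable D1 -> measurable D2 -> D1 `&` D2 = set0 ->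
    forall v, E D1 (E D2 v) = 0 by move=> *; exact: specm_disj.
have sum v : E O0 v + E Om v + E Op v + E (~` O) v = v.
  by rewrite (specm_C hE) // specm_O; vec.
have Opm : Op `&` Om = set0 by rewrite setIC sides_disjoint.
have [Fm [Fp [sFm sFp dF]]] := projection_near_window vA HS a0 b0 h0 Sm hm Sp hp hQ
  (bicomm_fixed kG) hG sum (z _ _ m0 mm core_left_disjoint)
  (z _ _ m0 mp core_right_disjoint) (z _ _ mm mp sides_disjoint) (z _ _ mp mm Opm)
  GB0 GBQ gapB.
have k0 : 0 <= 8 * (2 * e / d) + 3 * b by move: a0 b0; lra.
exists Fm, Fp, (2 * (8 * (2 * e / d) + 3 * b)); split => //.
- by rewrite mulr_ge0.
- rewrite /coef hd hw inver gt_eqF //= -EFin_max -EFinD -EFinM lee_fin.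
  set i := d^-1; have i0 : 0 <= i by rewrite invr_ge0.
  have h1 : 16 * i <= Num.max (16 * i) w by rewrite le_max lexx.
  have h2 : w <= Num.max (16 * i) w by rewrite le_max lexx orbT.
  have := ler_wpM2r e0 h1; have := ler_wpM2r e0 h2; have := mulr_ge0 w0 e0.
  set M := Num.max _ _; move=> h3 h4 h5.
  (* the maximum is at least the average of its arguments, and 32 b <= w e *)
  have -> : 2 * (8 * (2 * e * i) + 3 * b) = 32 * (i * e) + 6 * b by ring.
  rewrite mulrDl; lra.
move=> B B' b' t bB bB' cXB b'0 t0 hB ht.
apply: (commutator_near_projection hG bB bB') => //.
- by apply: comm_sym; apply: (kG.2 _ bB'); apply: comm_sym.
Qed.

End Choice.

Lemma band_of_spectral_measure : exists F Fm Fp : H -> H,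
    [/\ A F /\ projection F /\ S_symmetric S F,
        op_le (E O0) F /\ op_le F (E O),
        [/\ F = Fm + E O0 + Fp,
            A Fm /\ projection Fm /\ S_symmetric S Fm,
            A Fp /\ projection Fp /\ S_symmetric S Fp,
            op_le Fm (E Om)
          & op_le Fp (E Op)]
      & forall B B' : H -> H, A B -> A B' -> commutator X' B' = 0 ->
        (opnorm (commutator F B) <=
         (24%:E / set_dist (~` O) O0 +
          Order.max (16%:E / set_dist (~` O) O0)
                    (32%:E / set_dist Om Op)) *
         opnorm (X' - X)%R * opnorm B + opnorm (B' - B)%R)%E].
Proof.
have bX := fixed_op_bop vA sX; have bX' := fixed_op_bop vA sX'.
have [e [he e0 hbe _]] := opnormP (bop_sub bX' bX).
have [Fm [Fp [c [sFm sFp c0 hc hcomm]]]] := band_exists e0 hbe.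
have [h1 h2 h3] := band_properties sFm sFp.
exists (band Fm Fp), Fm, Fp; split => // B B' AB AB' cXB.
have bB := A_bop vA AB; have bB' := A_bop vA AB'.
have [b [hb b0 hbb _]] := opnormP bB.
have [t [ht t0 hbt _]] := opnormP (bop_sub bB' bB).
have cXB' : comm X' B'.
  move=> v; have /(congr1 (fun f => f v)) := cXB.
  by rewrite -[LHS]/(X' (B' v) - B' (X' v)) => /eqP; rewrite subr_eq0 => /eqP.
have hF := hcomm B B' b t bB bB' cXB' b0 t0 hbb hbt.
have bF : bounded_op (band Fm Fp) by case: h1 => _ [[]].
have bC : bounded_op (commutator (band Fm Fp) B).
  exact: (bop_sub (bop_comp bF bB) (bop_comp bB bF)).
have [n [hn n0 _ hmin]] := opnormP bC.
have hn' := hmin _ (addr_ge0 (mulr_ge0 c0 b0) t0) hF.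
have -> : opnorm (X' - X) = e%:E by exact: he.
have -> : opnorm (B' - B) = t%:E by exact: ht.
rewrite hn hb; apply: (@le_trans _ _ ((c * b + t)%:E)); first by rewrite lee_fin.
by rewrite EFinD leeD2r // EFinM lee_wpmul2r // lee_fin.
Qed.

End Final.

(** * The theorem *)

Theorem lemma6p8 (R : realType) (H : hilbertType R) (A : set (H -> H))
    (S : set ((H -> H) -> (H -> H))) (X X' : H -> H)
    (Omega0 Omega Omegam Omegap : set R) :
  von_neumann_algebra A ->
  (forall phi, S phi -> linear_symmetry A phi /\ weakly_continuous A phi) ->
  A X -> self_adjoint X -> S_symmetric S X ->
  A X' -> self_adjoint X' -> S_symmetric S X' ->
  is_interval Omega0 -> is_interval Omega ->
  compactly_contained Omega0 Omega ->
  is_interval Omegam -> is_interval Omegap ->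
  Omegam `|` Omegap = Omega `\` Omega0 ->
  (forall x y, Omegam x -> Omegap y -> x < y) ->
  exists F Fm Fp : H -> H,
    [/\ A F /\ projection F /\ S_symmetric S F,
        op_le (spectral_projection X Omega0) F /\
        op_le F (spectral_projection X Omega),
        [/\ F = Fm + spectral_projection X Omega0 + Fp,
            A Fm /\ projection Fm /\ S_symmetric S Fm,
            A Fp /\ projection Fp /\ S_symmetric S Fp,
            op_le Fm (spectral_projection X Omegam)
          & op_le Fp (spectral_projection X Omegap)]
      & forall B B' : H -> H, A B -> A B' -> commutator X' B' = 0 ->
        (opnorm (commutator F B) <=
         (24%:E / set_dist (~` Omega) Omega0 +
          Order.max (16%:E / set_dist (~` Omega) Omega0)
                    (32%:E / set_dist Omegam Omegap)) *
         opnorm (X' - X)%R * opnorm B + opnorm (B' - B)%R)%E].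
Proof.
move=> vA HS AX saX SX AX' saX' SX' iO0 iO cO im ip OU Olt.
have bX := A_bop vA AX; have bX' := A_bop vA AX'.
have symX : sym X by apply/sym_self_adjoint.
have symX' : sym X' by apply/sym_self_adjoint.
have [exE|noE] := pselect (exists E, is_spectral_measure X E).
  have hE := xgetPex (fun=> 0) exE.
  by apply: (band_of_spectral_measure vA HS (conj AX SX) symX (conj AX' SX') symX' hE).
(* without a spectral measure all spectral projections are 0 by convention *)
have sp0 D : spectral_projection X D = 0.
  by rewrite /spectral_projection xgetPN // => E hE; apply: noE; exists E.
have S0 : fixed_op A S (0 : H -> H) := fixed_op_0 vA HS.
have [A0 Sy0] := S0; have b0 := fixed_op_bop vA S0.
have p0 : projection (0 : H -> H).
  by split => // u v; rewrite linear0l linear0r.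
exists 0, 0, 0; rewrite !sp0; split => //; first by split => // u.
  by split=> //; rewrite ?addr0 // => u.
move=> B B' AB AB' _; have bB := A_bop vA AB; have bB' := A_bop vA AB'.
have -> : opnorm (commutator 0 B) = 0%E.
  have bC : bounded_op (commutator 0 B).
    exact: (bop_sub (bop_comp b0 bB) (bop_comp bB b0)).
  have [n [-> n0 _ hmin]] := opnormP bC; congr EFin; apply: le_anti; rewrite n0 andbT.
  apply: hmin => // v; rewrite -[commutator 0 B v]/(0 - B 0) (op0 bB) subrr nrm0.
  by rewrite mul0r.
have op_ge0 T : bounded_op T -> (0 <= opnorm T)%E.
  by move=> /opnormP[z [-> z0 _ _]]; rewrite lee_fin.
have [b1 b2] : bounded_op (X' - X) /\ bounded_op (B' - B).
  by split; exact: bop_sub.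
by rewrite adde_ge0 ?op_ge0 // mule_ge0 ?op_ge0 // mule_ge0 ?op_ge0 ?coef_ge0.
Qed.
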